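(* Assume: (i) (bounded kernel) there is $\kappa<\infty$ with $\|\psi_x\|_{\mathcal H}\le\kappa$ for all $x\in\mathcal X$; (ii) (well-specified model) $\|\mathcal K_u\|_{\mathrm{HS}}<\infty$ for all $u\in\mathcal U$; (iii) (source condition) for every $u\in\mathcal U$, with $\Sigma_u:=\int\psi_x\otimes\psi_x\,\rho_u(dx)\in\mathrm{HS}(\mathcal H)$, there exists $r_u\in(1/2,1]$ such that $\|\mathcal K_u\Sigma_u^{1/2-r_u}\|_{\mathrm{HS}}=:G_u<\infty$. Define $r:=\min_{u\in\mathcal U}r_u$. For every $u\in\mathcal U$ set $\gamma_u=c_u\,n^{-1/(2r_u+1)}$ for some $c_u>0$ (independent of $n$), and let $\widehat{\mathcal K}_u$ be the unique solution of $$\min_{W\in\mathrm{HS}(\mathcal H)}\left\{\frac1n\sum_{i=1}^n\big\|\psi_{\mathfrak f_u(x_i)}-W\psi_{x_i}\big\|_{\mathcal H}^2+\gamma_u\|W\|_{\mathrm{HS}}^2\right\},$$ where $x_1,\dots,x_n$ are i.i.d. samples from $\rho_u$ (for each $u$). Let $f(z,u):=\mathcal K_uz$ and $\hat f(z,u):=\widehat{\mathcal K}_uz$. Then there is a constant $A<\infty$, independent of $n$, $\delta$, $x$ and $u$, such that for every $n\ge1$ and every $\delta\in(0,1)$, with probability at least $1-\delta$, $$\big\|\hat f(\psi_x,u)-f(\psi_x,u)\big\|_{\mathcal H}\le A\,\log\!\big(2|\mathcal U|/\delta\big)\,\kappa\,n^{-\frac{2r-1}{4r+2}}\qquad\text{for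 all }x\in\mathcal X\text{ and all }u\in\mathcal U.$$
   Context: $\mathcal X$ is a measurable state space, $\mathcal U$ is a finite nonempty control set, $\mathfrak f:\mathcal X\times\mathcal U\to\mathcal X$ is a flow map, and $\mathfrak f_u(x)=\mathfrak f(x,u)$. $\mathcal H$ is the reproducing kernel Hilbert space of a real symmetric strictly positive definite kernel $k$ on $\mathcal X$ (for pairwise distinct points $x_i$ and reals $c_i$, $\sum_{i,j}c_ic_jk(x_i,x_j)\ge0$, with equality iff all $c_i=0$), and $\psi_x:=k(x,\cdot)$. Standing assumption: for each $u\in\mathcal U$ the linear map on $\mathcal H_0:=\operatorname{span}\{\psi_x:x\in\mathcal X\}$ determined by $\psi_x\mapsto\psi_{\mathfrak f_u(x)}$ is bounded with some constant $R_u<\infty$ with respect to $\|\cdot\|_{\mathcal H}$; $\mathcal K_u:\mathcal H\to\mathcal H$ denotes its unique bounded linear extension, so $\mathcal K_u\psi_x=\psi_{\mathfrak f_u(x)}$ and $\|\mathcal K_u\|\le R_u$. For each $u$, $\rho_u$ is a probability measure on $\mathcal X$ (design distribution), and $x\mapsto\psi_x$ is Bochner measurable so that $\Sigma_u$ is a well-defined Bochner integral; $(a\otimes b)h:=\langle h,b\rangle_{\mathcal H}\,a$. $\mathrm{HS}(\mathcal H)$ is the space of Hilbert–Schmidt operators on $\mathcal H$. The source condition, which involves a negative power of $\Sigma_u$, is understood as follows: there is an operator $B_u\in\mathrm{HS}(\mathcal H)$, vanishing on $\ker\Sigma_u$, with $\mathcal K_u=B_u\Sigma_u^{r_u-1/2}$,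 and $\mathcal K_u\Sigma_u^{1/2-r_u}$ denotes $B_u$, so that $G_u=\|B_u\|_{\mathrm{HS}}$. The constant $A$ may depend on $\kappa$ and on $r_u,G_u,R_u,c_u$ ($u\in\mathcal U$). *)

(* Defs.v *)
From HB Require Import structures.
From mathcomp Require Import all_boot all_order all_algebra.
From mathcomp Require Import all_classical all_reals all_analysis.

Set Implicit Arguments.
Unset Strict Implicit.
Unset Printing Implicit Defensive.

Import Order.TTheory GRing.Theory Num.Theory.
Import numFieldNormedType.Exports.

Local Open Scope classical_set_scope.
Local Open Scope ring_scope.

Record hilbertSpace (R : realType) := HilbertSpace {
  hilbert_carrier :> completeNormedModType R;
  hdot : {dot hilbert_carrier for idfun};
  hdot_normE : forall h : hilbert_carrier, `|h| ^+ 2 = hdot h h }.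

Definition inner (R : realType) (H : hilbertSpace R) (g h : H) : R :=
  hdot H g h.

Local Notation "''[' g , h ]" := (inner g h) : ring_scope.

Section HilbertSchmidt.
Context {R : realType} {H : hilbertSpace R}.

Definition orthonormal_system (E : set H) : Prop :=
  forall e e' : H, E e -> E e' -> '[e, e'] = (e == e')%:R.

Definition orthonormal_basis (E : set H) : Prop :=
  orthonormal_system E /\
  forall h : H, (forall e, E e -> '[h, e] = 0) -> h = 0.

Lemma innerC (g h : H) : '[g, h] = '[h, g].
Proof. by have := hermitian_subproof (s := hdot H) g h; rewrite expr0 mul1r. Qed.

Lemma innerZl (a : R) (g h : H) : '[a *: g, h] = a * '[g, h].
Proof. by rewrite /inner linearZl_LR. Qed.

Lemma innerZr (a : R) (g h : H) : '[g, a *: h] = a * '[g, h].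
Proof. by rewrite innerC innerZl innerC. Qed.

Lemma exists_orthonormal_basis : exists E : set H, orthonormal_basis E.
Proof.
have [F FP Ftot e e' [A FA Ae] [B FB Be]|E [Eo Emax]] :=
    @Zorn_bigcup H orthonormal_system.
  by have [AB|BA] := Ftot _ _ FA FB;
    [apply: (FP _ FB) => //; exact: AB | apply: (FP _ FA) => //; exact: BA].
exists E; split=> // h hE; apply/eqP/negP => /negP h0.
have nh0 : `|h| != 0 by rewrite normr_eq0.
pose b := `|h|^-1 *: h.
have bb : '[b, b] = 1.
  by rewrite innerZl innerZr [X in _ * (_ * X)]/inner -hdot_normE expr2 mulKf
    ?mulVf.
have bE e : E e -> '[b, e] = 0 by move=> Ee; rewrite innerZl hE// mulr0.
have nEb : ~ E b.
  by move=> /bE; rewrite bb => /eqP; rewrite oner_eq0.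
apply: (Emax (E `|` [set b])).
  split; first exact: subsetUl.
  by move=> /(_ b (or_intror erefl)).
have ne e : E e -> (b == e) = false.
  by move=> Ee; apply/negbTE/eqP => be; apply: nEb; rewrite be.
move=> e e' [Ee|->] [Ee'|->]; first exact: Eo.
- by rewrite innerC bE// eq_sym ne.
- by rewrite bE// ne.
- by rewrite bb eqxx.
Qed.

(** A fixed orthonormal basis; the Hilbert-Schmidt norm of a bounded operator
    does not depend on it.  [H] is not assumed separable, whence [esum]. *)
Definition hilbert_basis : set H := sval (cid exists_orthonormal_basis).

Definition bounded_linear (T : H -> H) : Prop := linear T /\ continuous T.

Definition hs_sqnorm (T : H -> H) : \bar R :=
  \esum_(e in hilbert_basis) (`|T e| ^+ 2)%:E.

(** Boundedness is required separately: an unbounded linear map may vanish on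
    [hilbert_basis]. *)
Definition HS : set (H -> H) :=
  [set T | bounded_linear T /\ (hs_sqnorm T < +oo)%E].

(** Meaningful on [HS] only, since [fine +oo = 0]. *)
Definition hs_norm (T : H -> H) : R := Num.sqrt (fine (hs_sqnorm T)).

Definition rank_one (a b : H) : H -> H := fun h => '[h, b] *: a.

(** [T = S ^ s] for a compact positive self-adjoint [S] and [s > 0]: [T] acts
    as [lam ^ s] on the eigenvectors of [S] with eigenvalue [lam]
    (recall [0 `^ s = 0] for [s != 0]). *)
Definition is_frac_power (S : H -> H) (s : R) (T : H -> H) : Prop :=
  bounded_linear T /\
  exists (E : set H) (lam : H -> R), orthonormal_basis E /\
    forall e, E e ->
      [/\ 0 <= lam e, S e = lam e *: e & T e = (lam e `^ s) *: e].

End HilbertSchmidt.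

Arguments HS {R} H.

Section Bochner.
Context {R : realType} {d : measure_display} {X : measurableType d}.

Record simpleFun (V : lmodType R) := SimpleFun {
  sf_size : nat;
  sf_set : 'I_sf_size -> set X;
  sf_val : 'I_sf_size -> V;
  sf_measurable : forall i, measurable (sf_set i) }.

Definition sf_fun (V : lmodType R) (s : simpleFun V) (x : X) : V :=
  \sum_(i < sf_size s) (\1_(sf_set i) x : R) *: sf_val i.

Definition sf_integral (V : lmodType R) (mu : probability X R)
    (s : simpleFun V) : V :=
  \sum_(i < sf_size s) fine (mu (sf_set i)) *: sf_val i.

Variables (V : lmodType R) (D : set V) (N : V -> R) (mu : probability X R).

(** The values live in the subspace [D] of [V], normed by [N]: either
    [D = setT] with the norm of [V], or [D = HS H] in [V = (H -> H)] with
    [N = hs_norm]. *)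
Definition bochner_approx (s : nat -> simpleFun V) (F : X -> V) : Prop :=
  (forall m i, D (sf_val (s := s m) i)) /\
  {ae mu, forall x, N (sf_fun (s m) x - F x) @[m --> \oo] --> 0}.

Definition bochner_measurable (F : X -> V) : Prop :=
  (forall x, D (F x)) /\ exists s, bochner_approx s F.

Definition is_bochner_integral (F : X -> V) (I : V) : Prop :=
  [/\ forall x, D (F x), D I & exists s : nat -> simpleFun V,
    [/\ bochner_approx s F,
        (\int[mu]_x (N (sf_fun (s m) x - F x))%:E)%E @[m --> \oo] --> 0%E &
        N (sf_integral mu (s m) - I) @[m --> \oo] --> 0]].

End Bochner.

Section RKHS.
Context {R : realType} {X : Type}.

Definition strictly_positive_definite (k : X -> X -> R) : Prop :=
  (forall x y, k x y = k y x) /\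
  forall (m : nat) (x : 'I_m -> X) (a : 'I_m -> R), injective x ->
    let q := \sum_(i < m) \sum_(j < m) a i * a j * k (x i) (x j) in
    0 <= q /\ (q = 0 <-> forall i, a i = 0).

(** A Hilbert space of functions on [X], the function represented by [h]
    being [rkhs_eval h]; [feature x] is the function [k x]. *)
Record rkhs (k : X -> X -> R) := Rkhs {
  rkhs_hilbert :> hilbertSpace R;
  rkhs_eval : rkhs_hilbert -> X -> R;
  rkhs_eval_linear : forall (a : R) (g h : rkhs_hilbert) (x : X),
    rkhs_eval (a *: g + h) x = a * rkhs_eval g x + rkhs_eval h x;
  rkhs_eval_inj : injective rkhs_eval;
  feature : X -> rkhs_hilbert;
  featureE : forall x, rkhs_eval (feature x) = k x;
  reproducing : forall (h : rkhs_hilbert) (x : X),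
    '[h, feature x] = rkhs_eval h x }.

Context {k : X -> X -> R} {H : rkhs k}.
Local Notation psi := (feature H).

(** The map [psi x |-> psi (g x)] extended linearly to the span of the
    features is bounded by [C]. *)
Definition span_bounded (g : X -> X) (C : R) : Prop :=
  forall (m : nat) (x : 'I_m -> X) (a : 'I_m -> R),
    `|\sum_(i < m) a i *: psi (g (x i))| <= C * `|\sum_(i < m) a i *: psi (x i)|.

(** Determines [K], the span of the features being dense. *)
Definition is_koopman (g : X -> X) (K : H -> H) : Prop :=
  bounded_linear K /\ forall x, K (psi x) = psi (g x).

Definition ridge_objective (g : X -> X) (n : nat) (x : 'I_n -> X) (gamma : R)
    (W : H -> H) : R :=
  n%:R^-1 * (\sum_(i < n) `|psi (g (x i)) - W (psi (x i))| ^+ 2)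
  + gamma * hs_norm W ^+ 2.

Definition is_ridge_solution (g : X -> X) (n : nat) (x : 'I_n -> X) (gamma : R)
    (W : H -> H) : Prop :=
  HS H W /\ forall W', HS H W' ->
    ridge_objective g x gamma W <= ridge_objective g x gamma W'.

End RKHS.

Arguments span_bounded {R X k} H g C.

Section Sampling.
Context {R : realType} {d d' : measure_display} {Omega : measurableType d'}
  {X : measurableType d}.

(** The product rule for subfamilies is the case where some [A i] are [setT]. *)
Definition mutually_independent (P : probability Omega R) (n : nat)
    (xi : 'I_n -> {RV P >-> X}) : Prop :=
  forall A : 'I_n -> set X, (forall i, measurable (A i)) ->
    P (\bigcap_(i in [set: 'I_n]) (xi i @^-1` A i))
    = (\prod_(i < n) P (xi i @^-1` A i))%E.

Definition iid_sample (P : probability Omega R) (rho : probability X R)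
    (n : nat) (xi : 'I_n -> {RV P >-> X}) : Prop :=
  (forall i A, measurable A -> distribution P (xi i) A = rho A) /\
  mutually_independent xi.

End Sampling.

(* Main.v *)
Require Import Defs.
From HB Require Import structures.
From mathcomp Require Import all_boot all_order all_algebra.
From mathcomp Require Import all_classical all_reals all_analysis.
From mathcomp Require Import finmap measurable_realfun ring lra.

Set Implicit Arguments.
Unset Strict Implicit.
Unset Printing Implicit Defensive.

Import Order.TTheory GRing.Theory Num.Theory.
Import numFieldNormedType.Exports.

Local Open Scope classical_set_scope.
Local Open Scope ring_scope.

(** The labels of the regression carry no noise: [psi (flow x u)] is the image of
    [psi x] by the operator [K u] to be learned. Let [C] be the empirical
    covariance of a sample and [W] the ridge solution with parameter [gamma].
    The normal equations read [W (C + gamma) = K C], so that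
    [W - K = - gamma K (C + gamma)^-1]: the error is pure bias, and random only
    through [C]. Write [K = B S] with [S = Sigma ^ s] and [s = r - 1/2], fix [h]
    and let [v] solve [(C + gamma) v = h]. On the eigenvectors of [Sigma],
    [gamma lam^s <= gamma^s (lam + gamma)], whence
    [gamma |S v| <= gamma^s |(Sigma + gamma) v|]. Since
    [(Sigma + gamma) v = h - (C - Sigma) v] and [gamma |v| <= |h|],
<<
      |W h - K h| <= |B| gamma^s (1 + |C - Sigma| / gamma) |h|
>>
    where [|B|] is the Hilbert-Schmidt norm; this is [ridge_error_le]. As
    [gamma] is of order [n ^ (- 1/(2 r + 1))], the factor [gamma^s] has the
    announced rate, and [gamma] dominates [n ^ (- 1/2)]. It remains to show that
    [|C - Sigma|] is of order [n ^ (- 1/2)] times the logarithm of the inverse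
    probability of failure ([cov_concentration]), and to sum the probabilities
    of failure over the controls.

    The concentration is reduced to finite sums. [discretize] replaces the law
    of the sample by a law on finitely many cells, at an arbitrarily small cost
    in operator norm and in probability. A sample then becomes a word over the
    set of cells, and [path_sum_tail] bounds the total weight of the bad words:
    a Gaussian moment of the norm of a sum of centered vectors is controlled by
    induction on the length of the word. The vectors live in the space of
    coefficients, with the Gram form of the rank-one operators.

    Hilbert-Schmidt operators are accessible through [hs_norm_rank_one], which
    expands the square norm of a rank-one perturbation. It rests on the density
    of Fourier sums in an orthonormal basis ([fourier_sum_dense]). *)

Local Notation "''[' g , h ]" := (inner g h) : ring_scope.

(** * Inner products and bounded operators *)

Section Inner.
Context {R : realType} {H : hilbertSpace R}.
Implicit Types (g h a b e : H).

Lemma innerDl g g' h : '[g + g', h] = '[g, h] + '[g', h].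
Proof. by rewrite /inner linearDl. Qed.

Lemma innerDr g h h' : '[g, h + h'] = '[g, h] + '[g, h'].
Proof. by rewrite innerC innerDl !(innerC g). Qed.

Lemma innerNl g h : '[- g, h] = - '[g, h].
Proof. by rewrite -scaleN1r innerZl mulN1r. Qed.

Lemma innerBl g g' h : '[g - g', h] = '[g, h] - '[g', h].
Proof. by rewrite innerDl innerNl. Qed.

Lemma innerBr g h h' : '[g, h - h'] = '[g, h] - '[g, h'].
Proof. by rewrite innerC innerBl !(innerC g). Qed.

Lemma inner0l h : '[0, h] = 0.
Proof. by rewrite -(scale0r 0) innerZl mul0r. Qed.

Lemma inner_suml (I : Type) (s : seq I) (F : I -> H) h :
  '[\sum_(i <- s) F i, h] = \sum_(i <- s) '[F i, h].
Proof.
elim: s => [|i s IH]; first by rewrite !big_nil inner0l.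
by rewrite !big_cons innerDl IH.
Qed.

Lemma innerE h : '[h, h] = `|h| ^+ 2.
Proof. by rewrite hdot_normE. Qed.

Lemma inner_ge0 h : 0 <= '[h, h].
Proof. by rewrite innerE sqr_ge0. Qed.

Lemma normD_sqr g h : `|g + h| ^+ 2 = `|g| ^+ 2 + '[g, h] *+ 2 + `|h| ^+ 2.
Proof. rewrite -!innerE innerDl !innerDr (innerC h g); ring. Qed.

Lemma inner_eq0 h : (forall a, '[h, a] = 0) -> h = 0.
Proof.
move=> /(_ h)/eqP; rewrite innerE expf_eq0/= normr_eq0 => /eqP; exact.
Qed.

End Inner.

(** The inner product of a Hilbert space is an instance, and so is the Gram
    form of a family of rank-one operators, which may be degenerate: hence a
    form on a vector space rather than an inner product. *)
Definition psd_form (R : realType) (V : lmodType R) (f : V -> V -> R) :=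
  [/\ forall a u v w, f (a *: u + v) w = a * f u w + f v w,
      forall u v, f u v = f v u & forall v, 0 <= f v v].

Section Psd.
Context {R : realType} {V : lmodType R} (f : V -> V -> R) (fP : psd_form f).

Lemma psdDl u v w : f (u + v) w = f u w + f v w.
Proof. by case: fP => fl _ _; rewrite -(scale1r u) fl mul1r scale1r. Qed.

Lemma psdZl a u w : f (a *: u) w = a * f u w.
Proof.
case: fP => fl _ _; have f0 : f 0 w = 0.
  by have := fl 1 0 0 w; rewrite scaler0 addr0; lra.
by rewrite -(addr0 (a *: u)) fl f0 addr0.
Qed.

Lemma psdD u v : f (u + v) (u + v) = f u u + f u v *+ 2 + f v v.
Proof.
case: fP => _ fs _; have fD w : f w (u + v) = f w u + f w v.
  by rewrite fs psdDl !(fs w).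
by rewrite psdDl !fD (fs v u); ring.
Qed.

(** The discriminant of [t |-> f (u + t v) (u + t v)], with the case [f v v
    = 0] apart as the form may be degenerate. *)
Lemma psd_CauchySchwarz u v : f u v ^+ 2 <= f u u * f v v.
Proof.
case: (fP) => fl fs f0.
have q (t : R) : 0 <= f u u + t * f u v *+ 2 + t ^+ 2 * f v v.
  have fZ w : f w (t *: v) = t * f w v by rewrite fs psdZl fs.
  have := f0 (u + t *: v); rewrite psdD fZ fZ psdZl.
  by congr (_ <= _); ring.
have [v0|v0] := eqVneq (f v v) 0.
  have [->|uv0] := eqVneq (f u v) 0; first by rewrite expr2 mul0r v0 mulr0.
  (* the affine function takes the value [-1] there *)
  have := q (- (f u u + 1) / (f u v *+ 2)).
  rewrite v0 mulr0 addr0 -mulrnAr divfK ?mulrn_eq0//; lra.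
have vgt : 0 < f v v by rewrite lt0r v0 f0.
have := q (- (f u v / f v v)).
have -> : f u u + - (f u v / f v v) * f u v *+ 2 + (- (f u v / f v v)) ^+ 2 * f v v
  = f u u - f u v ^+ 2 / f v v by field.
by rewrite subr_ge0 ler_pdivrMr.
Qed.

End Psd.

Section Operators.
Context {R : realType} {H : hilbertSpace R}.
Implicit Types (g h a b e : H) (T : H -> H).

Lemma inner_psd : psd_form (fun g h : H => '[g, h]).
Proof.
split=> [a u v w|u v|v]; first by rewrite innerDl innerZl.
  exact: innerC.
exact: inner_ge0.
Qed.

Lemma norm_inner_le g h : `|'[g, h]| <= `|g| * `|h|.
Proof.
have := psd_CauchySchwarz inner_psd g h.
rewrite !innerE -exprMn => q; rewrite -(@ler_pXn2r _ 2%N) ?nnegrE ?mulr_ge0//.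
by rewrite real_normK ?num_real.
Qed.

Lemma linear0_of T : linear T -> T 0 = 0.
Proof. by move=> lT; have := lT (-1) 0 0; rewrite scaler0 add0r scaleN1r addNr. Qed.

Lemma linearD_of T g h : linear T -> T (g + h) = T g + T h.
Proof. by move=> lT; have := lT 1 g h; rewrite !scale1r. Qed.

Lemma linearZ_of T (c : R) h : linear T -> T (c *: h) = c *: T h.
Proof. by move=> lT; have := lT c h 0; rewrite (linear0_of lT) !addr0. Qed.

Lemma linearB_of T g h : linear T -> T (g - h) = T g - T h.
Proof. by move=> lT; rewrite (linearD_of _ _ lT) -scaleN1r (linearZ_of _ _ lT) scaleN1r. Qed.

Definition op_bound T (c : R) : Prop := forall h, `|T h| <= c * `|h|.

Lemma op_bound_le T c c' : c <= c' -> op_bound T c -> op_bound T c'.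
Proof. by move=> cc Tc h; apply: (le_trans (Tc h)); rewrite ler_wpM2r. Qed.

Lemma op_boundD T T' c c' :
  op_bound T c -> op_bound T' c' -> op_bound (T + T') (c + c').
Proof.
move=> Tc Tc' h; rewrite mulrDl; apply: (le_trans (ler_normD _ _)).
exact: lerD.
Qed.

Lemma op_boundN T c : op_bound T c -> op_bound (- T) c.
Proof. by move=> Tc h; rewrite normrN. Qed.

Lemma op_boundZ (a : R) T c : op_bound T c -> op_bound (a *: T) (`|a| * c).
Proof. by move=> Tc h; rewrite normrZ -mulrA ler_wpM2l. Qed.

Lemma op_bound_sum (I : finType) (P : pred I) (T : I -> H -> H) (c : I -> R) :
  (forall i, P i -> op_bound (T i) (c i)) ->
  op_bound (\sum_(i | P i) T i) (\sum_(i | P i) c i).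
Proof.
move=> Tc; elim/big_ind2 : _ => [h|T1 c1 T2 c2|//]; last exact: op_boundD.
by rewrite normr0 mul0r.
Qed.

Lemma op_bound_continuous T c : linear T -> op_bound T c -> continuous T.
Proof.
move=> lT Tc x; apply/cvgrPdist_le => /= e e0.
near=> y; rewrite -(linearB_of _ _ lT); apply: (le_trans (Tc _)).
have c0 : 0 < `|c| + 1 by rewrite ltr_pwDr.
apply: (@le_trans _ _ ((`|c| + 1) * `|x - y|)).
  by rewrite ler_wpM2r// (le_trans (ler_norm _))// lerDl.
rewrite mulrC -ler_pdivlMr//; near: y.
by apply: cvgr_dist_le; [exact: cvg_id | rewrite divr_gt0].
Unshelve. all: by end_near. Qed.

Lemma op_bound_ex T : bounded_linear T -> exists2 C, 0 <= C & op_bound T C.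
Proof.
move=> [lT cT].
pose f : {linear H -> H} := HB.pack T (GRing.isLinear.Build R H H *:%R T lT).
have /linear_boundedP bf : bounded_near f (nbhs 0).
  by apply: continuous_linear_bounded; exact: cT.
near (pinfty_nbhs R) => C; exists C => //; last by near: C; exact: bf.
Unshelve. all: by end_near. Qed.

Lemma bounded_linear_of T c : linear T -> op_bound T c -> bounded_linear T.
Proof. by move=> lT Tc; split => //; exact: op_bound_continuous Tc. Qed.

Lemma bounded_linearD T T' :
  bounded_linear T -> bounded_linear T' -> bounded_linear (T + T').
Proof.
move=> bT bT'; have [C _ TC] := op_bound_ex bT; have [C' _ TC'] := op_bound_ex bT'.
apply: (bounded_linear_of _ (op_boundD TC TC')) => a u v.
case: bT bT' => lT _ [lT' _]; rewrite !fctE lT lT' scalerDr.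
by rewrite -!addrA; congr (_ + _); rewrite addrCA.
Qed.

Lemma bounded_linearZ (c : R) T : bounded_linear T -> bounded_linear (c *: T).
Proof.
move=> bT; have [C _ TC] := op_bound_ex bT.
apply: (bounded_linear_of _ (op_boundZ c TC)) => a u v.
by case: bT => lT _; rewrite !fctE lT scalerDr !scalerA mulrC.
Qed.

Lemma id_bounded_linear : bounded_linear (id : H -> H).
Proof.
by apply: (@bounded_linear_of _ 1) => [c u v //|h]; rewrite mul1r.
Qed.

Lemma rank_one_op_bound a b : op_bound (rank_one a b) (`|a| * `|b|).
Proof.
move=> h; rewrite /rank_one normrZ mulrC -mulrA ler_wpM2l// mulrC.
exact: norm_inner_le.
Qed.

Lemma rank_one_bounded_linear a b : bounded_linear (rank_one a b).
Proof.
apply: (bounded_linear_of _ (rank_one_op_bound a b)) => c u v.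
by rewrite /rank_one innerDl innerZl scalerDl scalerA.
Qed.

End Operators.

(** * Fourier sums in an orthonormal basis *)

Section Fourier.
Context {R : realType} {H : hilbertSpace R}.
Implicit Types (g h a b e : H) (T : H -> H) (E : set H) (s : seq H).

(** Finite subsets are duplicate-free sequences, so that sums over them are
    ordinary big operators. As the space may be nonseparable, a basis is
    exhausted by its finite parts and not by the initial segments of an
    enumeration. *)
Definition finite_part E s : Prop := uniq s /\ [set` s] `<=` E.

Definition fourier_sum s h : H := \sum_(e <- s) '[h, e] *: e.

Lemma linear_fourier T s h : linear T ->
  \sum_(e <- s) '[h, e] *: T e = T (fourier_sum s h).
Proof.
move=> lT.
elim: s => [|e s IH]; first by rewrite /fourier_sum !big_nil linear0_of.
by rewrite /fourier_sum !big_cons lT IH.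
Qed.

Lemma finite_partU E s s' : finite_part E s -> finite_part E s' ->
  finite_part E (undup (s ++ s')).
Proof.
move=> [_ sE] [_ sE']; split; first exact: undup_uniq.
move=> e /=; rewrite mem_undup mem_cat => /orP[] es; [exact: sE|exact: sE'].
Qed.

Lemma ler_sum_sub_uniq (I : eqType) (s s' : seq I) (F : I -> R) :
  uniq s -> uniq s' -> {subset s <= s'} -> (forall i, 0 <= F i) ->
  \sum_(i <- s) F i <= \sum_(i <- s') F i.
Proof.
move=> us us' ss' F0.
have pe : perm_eq [seq i <- s' | i \in s] s.
  apply: uniq_perm => //; first exact: filter_uniq.
  by move=> i; rewrite mem_filter; have [/ss' ->|//] := boolP (i \in s).
rewrite [leRHS](bigID (mem s))/= -[X in _ <= X + _]big_filter (perm_big _ pe)/=.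
by rewrite lerDl sumr_ge0.
Qed.

Lemma orthonormal_coef E s (c : H -> R) e : orthonormal_system E ->
  finite_part E s -> E e ->
  '[\sum_(e' <- s) c e' *: e', e] = if e \in s then c e else 0.
Proof.
move=> oE [us sE] Ee; rewrite inner_suml.
have -> : \sum_(i <- s) '[c i *: i, e] = \sum_(i <- s) (if i == e then c i else 0).
  apply: eq_big_seq => i si; rewrite innerZl oE//; last exact: sE.
  by case: eqP => _; rewrite ?mulr1 ?mulr0.
rewrite -big_mkcond/=; case: ifP => es.
  by rewrite -big_filter filter_pred1_uniq// big_seq1.
rewrite big_seq_cond big_pred0// => i; apply/negP => /andP[si /eqP ie].
by rewrite -ie si in es.
Qed.

Lemma orthonormal_sqnorm E s (c : H -> R) : orthonormal_system E ->
  finite_part E s -> `|\sum_(e <- s) c e *: e| ^+ 2 = \sum_(e <- s) c e ^+ 2.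
Proof.
move=> oE sE; rewrite -innerE inner_suml; apply: eq_big_seq => e es.
by rewrite innerZl innerC (orthonormal_coef _ oE)// ?es ?expr2//; case: sE => _; exact.
Qed.

(** Pythagoras: a Fourier sum is an orthogonal projection. *)
Lemma Bessel_eq E s h : orthonormal_system E -> finite_part E s ->
  `|h - fourier_sum s h| ^+ 2 = `|h| ^+ 2 - \sum_(e <- s) '[h, e] ^+ 2.
Proof.
move=> oE sE; rewrite normD_sqr normrN.
rewrite (orthonormal_sqnorm _ oE)// innerC innerNl inner_suml.
have -> : \sum_(i <- s) '['[h, i] *: i, h] = \sum_(i <- s) '[h, i] ^+ 2.
  by apply: eq_bigr => i _; rewrite innerZl innerC expr2.
ring.
Qed.

Lemma Bessel_le E s h : orthonormal_system E -> finite_part E s ->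
  \sum_(e <- s) '[h, e] ^+ 2 <= `|h| ^+ 2.
Proof. by move=> oE sE; rewrite -subr_ge0 -(Bessel_eq _ oE)// sqr_ge0. Qed.

Lemma fourier_sum_closer E s s' h : orthonormal_system E ->
  finite_part E s -> finite_part E s' -> {subset s <= s'} ->
  `|h - fourier_sum s' h| <= `|h - fourier_sum s h|.
Proof.
move=> oE sE sE' ss'; rewrite -(@ler_pXn2r _ 2%N) ?nnegrE// !(Bessel_eq _ oE)//.
rewrite lerD2l lerN2; apply: ler_sum_sub_uniq => //; last first.
  by move=> e; exact: sqr_ge0.
  by case: sE'.
by case: sE.
Qed.

Lemma fourier_sumB E s s' h : orthonormal_system E ->
  finite_part E s -> finite_part E s' -> {subset s <= s'} ->
  `|fourier_sum s' h - fourier_sum s h| ^+ 2 =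
  \sum_(e <- s') '[h, e] ^+ 2 - \sum_(e <- s) '[h, e] ^+ 2.
Proof.
move=> oE sE sE' ss'.
have D : h - fourier_sum s h =
    (h - fourier_sum s' h) + (fourier_sum s' h - fourier_sum s h).
  by rewrite addrA subrK.
have := Bessel_eq h oE sE; rewrite D (normD_sqr (h - _)) (Bessel_eq h oE sE').
suff -> : '[h - fourier_sum s' h, fourier_sum s' h - fourier_sum s h] = 0 by lra.
have o e : e \in s' -> '[h - fourier_sum s' h, e] = 0.
  move=> es; rewrite innerBl (orthonormal_coef _ oE) ?es ?subrr//.
  by case: sE' => _; exact.
rewrite innerBr !(innerC (h - _)) !inner_suml !big1_seq ?subrr//.
  by move=> e /= es; rewrite innerZl (innerC e) o ?mulr0// ss'.
by move=> e /= es; rewrite innerZl (innerC e) o ?mulr0.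
Qed.

Lemma near_inv_lt (x : R) : 0 < x -> \forall n \near \oo, n.+1%:R^-1 < x.
Proof. by move=> x0; exact: (near_infty_natSinv_lt (PosNum x0)). Qed.

(** Fourier sums over finite parts that nearly maximise the sum of squared
    coefficients form a Cauchy sequence. Its limit has the coefficients of [h],
    since adding a basis vector to a nearly maximal part cannot gain much, and
    the basis is complete. *)
Lemma fourier_sum_dense E h (eps : R) : orthonormal_basis E -> 0 < eps ->
  exists2 s, finite_part E s & `|h - fourier_sum s h| <= eps.
Proof.
move=> [oE cE] eps0.
pose q s := \sum_(e <- s) '[h, e] ^+ 2.
pose A := [set q s | s in finite_part E].
have fp0 : finite_part E [::] by split.
have supA : has_sup A.
  split; first by exists (q [::]), [::].
  by exists (`|h| ^+ 2) => _ [s sE <-]; exact: (Bessel_le _ oE).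
have sqx n : exists s, finite_part E s /\ sup A - n.+1%:R^-1 ^+ 2 < q s.
  have n0 : 0 < n.+1%:R^-1 ^+ 2 :> R by rewrite exprn_gt0// invr_gt0.
  by have [_ [s sE <-] ?] := sup_adherent n0 supA; exists s.
have [sq sqP] := choice sqx.
have sqE n := (sqP n).1; have sqM n := (sqP n).2.
have qM s : finite_part E s -> q s <= sup A.
  by move=> sE; apply: sup_upper_bound => //; exists s.
pose p n := fourier_sum (sq n) h.
(* enlarging [sq n] moves the Fourier sum by at most [n.+1%:R^-1] *)
have near_max n s : finite_part E s -> {subset sq n <= s} ->
    `|fourier_sum s h - p n| <= n.+1%:R^-1.
  move=> sE ss; rewrite -(@ler_pXn2r _ 2%N) ?nnegrE//.
  rewrite (fourier_sumB _ oE)// lerBlDr; apply: (le_trans (qM _ sE)).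
  by rewrite addrC -lerBlDr ltW.
have pp n m : `|p n - p m| <= n.+1%:R^-1 + m.+1%:R^-1.
  have uE := finite_partU (sqE n) (sqE m).
  rewrite -(subrKA (fourier_sum (undup (sq n ++ sq m)) h)).
  apply: (le_trans (ler_normD _ _)); apply: lerD; last first.
    by apply: near_max => // e em; rewrite mem_undup mem_cat em orbT.
  by rewrite distrC; apply: near_max => // e em; rewrite mem_undup mem_cat em.
have cp : cvg (p @ \oo).
  apply: cauchy_cvg; apply: cauchy_exP => e /= e0.
  near \oo => N; exists (p N); near=> n => /=.
  rewrite -ball_normE /ball_/=; apply: (le_lt_trans (pp _ _)).
  rewrite [ltRHS]splitr ltrD//.
    near: N; by apply: near_inv_lt; rewrite divr_gt0.
  near: n; by apply: near_inv_lt; rewrite divr_gt0.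
have ph : lim (p @ \oo) = h.
  apply/esym/eqP; rewrite -subr_eq0; apply/eqP/cE => e Ee.
  apply/eqP; rewrite -normr_le0; apply/ler_addgt0Pr => x x0.
  have e1 : `|e| = 1.
    by apply/eqP; rewrite -sqrp_eq1// -innerE oE// eqxx.
  have he n : `|'[h - p n, e]| <= n.+1%:R^-1.
    have [es|es] := boolP (e \in sq n).
      by rewrite innerBl (orthonormal_coef _ oE)// es subrr normr0.
    have sE : finite_part E (e :: sq n).
      split; first by rewrite /= es; case: (sqE n).
      by move=> e' /=; rewrite inE => /orP[/eqP->//|]; case: (sqE n) => _; exact.
    have -> : '[h - p n, e] = '[h, e].
      by rewrite innerBl (orthonormal_coef _ oE)// (negbTE es) subr0.
    rewrite -(@ler_pXn2r _ 2%N) ?nnegrE// real_normK ?num_real//.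
    have := qM _ sE; rewrite /q big_cons -lerBrDr => /le_trans; apply.
    by rewrite lerBlDl -lerBlDr ltW.
  near \oo => n; rewrite add0r.
  rewrite -(subrKA (p n)) innerDl (le_trans (ler_normD _ _))//.
  rewrite [leRHS]splitr lerD//.
    apply: (le_trans (he n)); apply: ltW.
    near: n; by apply: near_inv_lt; rewrite divr_gt0.
  rewrite (le_trans (norm_inner_le _ _))// e1 mulr1 distrC.
  by near: n; apply: cvgr_dist_le => //; rewrite divr_gt0.
near \oo => n; exists (sq n) => //; rewrite -/(p n) -ph.
by near: n; apply: cvgr_dist_le.
Unshelve. all: by end_near. Qed.

(** For operators diagonal in [E] this reduces an inequality of norms to one
    between eigenvalues. *)
Lemma norm_le_of_basis (E : set H) (P Q : H -> H) : orthonormal_basis E ->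
  bounded_linear P -> bounded_linear Q ->
  (forall v s, finite_part E s ->
    `|P (fourier_sum s v)| <= `|Q (fourier_sum s v)|) ->
  forall v, `|P v| <= `|Q v|.
Proof.
move=> oE bP bQ PQ v; apply/ler_addgt0Pr => eps eps0.
have [C C0 PC] := op_bound_ex bP; have [D D0 QD] := op_bound_ex bQ.
have [lP _] := bP; have [lQ _] := bQ.
have d0 : 0 < eps / (C + D + 1) by rewrite divr_gt0// ltr_wpDl// addr_ge0.
have [s sE vs] := fourier_sum_dense v oE d0; set u := fourier_sum s v in vs.
have e1 : (C + D + 1) * (eps / (C + D + 1)) = eps.
  by rewrite mulrC divfK// gt_eqF// ltr_wpDl// addr_ge0.
have h1 : `|P v| <= `|P (v - u)| + `|P u|.
  by rewrite -{1}(subrK u v) (linearD_of (v - u) u lP) ler_normD.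
have h2 : `|Q u| <= `|Q v| + `|Q (v - u)|.
  rewrite -{1}(subKr v u) (linearB_of v (v - u) lQ) -(normrN (Q (v - u))).
  exact: ler_normD.
have h3 := le_trans (PC (v - u)) (ler_wpM2l C0 vs).
have h4 := le_trans (QD (v - u)) (ler_wpM2l D0 vs).
have h5 := PQ v s sE; rewrite -/u in h5.
have h6 : eps = C * (eps / (C + D + 1)) + D * (eps / (C + D + 1)) + eps / (C + D + 1).
  by rewrite -[LHS]e1; ring.
move: h1 h2 h3 h4 h5 h6 d0; move: (eps / _) => x; lra.
Qed.

End Fourier.

(** * The Hilbert-Schmidt norm *)

Section HilbertSchmidtNorm.
Context {R : realType} {H : hilbertSpace R}.
Implicit Types (g h a b e : H) (T : H -> H) (s : seq H).

Let basis : set H := hilbert_basis.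
Let basisP : orthonormal_basis basis := svalP (cid exists_orthonormal_basis).

Definition hs_part T s : R := \sum_(e <- s) `|T e| ^+ 2.

Lemma hs_part_le_sqnorm T s : finite_part basis s ->
  ((hs_part T s)%:E <= hs_sqnorm T)%E.
Proof.
move=> [us sE]; apply: esum_ge; exists [set` s].
  by split => //; exact: finite_seq.
by rewrite -fsbig_seq// /hs_part sumEFin.
Qed.

Lemma hs_sqnorm_ge0 T : (0 <= hs_sqnorm T)%E.
Proof. by apply: esum_ge0 => e _; rewrite lee_fin sqr_ge0. Qed.

Lemma hs_normE T : HS H T -> hs_sqnorm T = (hs_norm T ^+ 2)%:E.
Proof.
move=> [_ Too]; rewrite sqr_sqrtr ?fine_ge0 ?hs_sqnorm_ge0// fineK//.
by rewrite ge0_fin_numE ?hs_sqnorm_ge0.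
Qed.

Lemma hs_norm_ge0 T : 0 <= hs_norm T.
Proof. exact: sqrtr_ge0. Qed.

Lemma hs_part_le T s : HS H T -> finite_part basis s ->
  hs_part T s <= hs_norm T ^+ 2.
Proof. by move=> HT sE; rewrite -lee_fin -hs_normE// hs_part_le_sqnorm. Qed.

Lemma hs_part_dense T (eps : R) : HS H T -> 0 < eps ->
  exists2 s, finite_part basis s & hs_norm T ^+ 2 - eps <= hs_part T s.
Proof.
move=> HT eps0.
have : ((hs_norm T ^+ 2 - eps)%:E < hs_sqnorm T)%E.
  by rewrite hs_normE// lte_fin ltrBlDr ltrDl.
rewrite /hs_sqnorm /esum => /ereal_sup_gt[_ [A [finA AE] <-]].
rewrite fsbig_finite//= sumEFin lte_fin => /ltW lt.
exists (fset_set A) => //; split; first exact: fset_uniq.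
by move=> e /=; rewrite in_fset_set// => /set_mem /AE.
Qed.

Lemma HS_le T (c : R) : bounded_linear T ->
  (forall s, finite_part basis s -> hs_part T s <= c) ->
  HS H T /\ hs_norm T ^+ 2 <= c.
Proof.
move=> bT Tc.
have le : (hs_sqnorm T <= c%:E)%E.
  apply: ge_ereal_sup => _ [A [finA AE] <-].
  rewrite fsbig_finite//= sumEFin lee_fin; apply: Tc; split; first exact: fset_uniq.
  by move=> e /=; rewrite in_fset_set// => /set_mem /AE.
have HT : HS H T by split => //; apply: (le_lt_trans le); rewrite ltry.
by split => //; rewrite -lee_fin -hs_normE.
Qed.

Lemma hs_part_rank_one T s (t : R) a b : linear T -> finite_part basis s ->
  hs_part (T + t *: rank_one a b) s = hs_part T s
    + t * '[T (fourier_sum s b), a] *+ 2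
    + t ^+ 2 * (`|a| ^+ 2 * `|fourier_sum s b| ^+ 2).
Proof.
move=> lT sE; rewrite /fourier_sum (orthonormal_sqnorm _ basisP.1)//.
rewrite -/(fourier_sum s b) -linear_fourier// inner_suml -mulrnAr -sumrMnl.
rewrite !mulr_sumr -!big_split/=; apply: eq_bigr => e _.
rewrite !fctE normD_sqr /rank_one; congr (_ + _ + _).
  by rewrite innerZl innerC !innerZl (innerC a) (innerC e); ring.
by rewrite !normrZ !exprMn !real_normK ?num_real// (innerC e); ring.
Qed.

(** This expansion plays the role of the Hilbert-Schmidt inner product with
    a rank-one operator, [<T, rank_one a b> = <T b, a>]. It yields the bound of
    the operator norm, the optimality condition of ridge regression and the norm
    of a combination of rank-one operators. On a finite part of the basis it
    holds with [b] replaced by its Fourier sum; large finite parts give both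
    inequalities. *)
Lemma hs_norm_rank_one T (t : R) a b : HS H T ->
  HS H (T + t *: rank_one a b) /\
  hs_norm (T + t *: rank_one a b) ^+ 2 =
    hs_norm T ^+ 2 + t * '[T b, a] *+ 2 + t ^+ 2 * (`|a| ^+ 2 * `|b| ^+ 2).
Proof.
move=> HT; have [bT _] := HT; have [lT _] := bT.
have [C C0 TC] := op_bound_ex bT.
set V := T + _; set c := _ + t ^+ 2 * _.
have bV : bounded_linear V.
  by apply: bounded_linearD => //; apply/bounded_linearZ/rank_one_bounded_linear.
(* [K x] bounds the error of replacing [b] by a Fourier sum at distance [x] *)
pose K := `|t| * (C * `|a|) *+ 2.
have K0 : 0 <= K by rewrite mulrn_wge0// mulr_ge0// mulr_ge0.
have Tb s x : `|b - fourier_sum s b| <= x ->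
    `|t * '[T (fourier_sum s b), a] *+ 2 - t * '[T b, a] *+ 2| <= K * x.
  move=> bx; rewrite -mulrnBl -mulrBr -innerBl -(linearB_of _ _ lT).
  rewrite normrMn normrM /K mulrnAl lerMn2r/= -mulrA ler_wpM2l//.
  apply: (le_trans (norm_inner_le _ _)); rewrite mulrAC ler_wpM2r//.
  by apply: (le_trans (TC _)); rewrite ler_wpM2l// distrC.
have up s : finite_part basis s -> hs_part V s <= c.
  move=> sE; apply/ler_addgt0Pr => eps eps0.
  have d0 : 0 < eps / (K + 1) by rewrite divr_gt0// ltr_wpDl.
  have [s' s'E bs'] := fourier_sum_dense b basisP d0.
  have uE := finite_partU sE s'E; set u := undup _ in uE.
  have bu : `|b - fourier_sum u b| <= eps / (K + 1).
    apply: le_trans bs'; apply: (fourier_sum_closer _ basisP.1) => // e es.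
    by rewrite mem_undup mem_cat es orbT.
  apply: (@le_trans _ _ (hs_part V u)).
    apply: ler_sum_sub_uniq => //; [by case: sE|by case: uE|].
    by move=> e es; rewrite mem_undup mem_cat es.
  rewrite hs_part_rank_one// /c.
  have h1 := hs_part_le HT uE.
  have h2 : `|fourier_sum u b| ^+ 2 <= `|b| ^+ 2.
    rewrite /fourier_sum (orthonormal_sqnorm _ basisP.1)//.
    exact: (Bessel_le _ basisP.1).
  have h3 : t ^+ 2 * (`|a| ^+ 2 * `|fourier_sum u b| ^+ 2) <=
            t ^+ 2 * (`|a| ^+ 2 * `|b| ^+ 2).
    by rewrite ler_wpM2l ?sqr_ge0// ler_wpM2l ?sqr_ge0.
  have := Tb u _ bu; rewrite ler_norml => /andP[_ h4].
  have h5 : K * (eps / (K + 1)) <= eps.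
    rewrite mulrCA ger_pMr// ler_pdivrMr ?mul1r ?lerDl// ltr_wpDl//.
  lra.
have [HV Vc] := HS_le bV up; split=> //.
apply/eqP; rewrite eq_le Vc/=; apply/ler_addgt0Pr => eps eps0.
(* [M] also accounts for the error made in the quadratic term *)
pose M := K + 1 + t ^+ 2 * `|a| ^+ 2.
have M0 : 0 < M by rewrite ltr_pwDl ?ltr_wpDl// mulr_ge0 ?sqr_ge0.
pose d := Num.min 1 (eps / 2 / M).
have d0 : 0 < d by rewrite lt_min ltr01/= !divr_gt0.
have dM : d * M <= eps / 2.
  by rewrite -ler_pdivlMr// ge_min lexx orbT.
have [s sE bs] := fourier_sum_dense b basisP d0.
have [s' s'E Ts'] := hs_part_dense HT (divr_gt0 eps0 (ltr0Sn R 1)).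
have uE := finite_partU sE s'E; set u := undup _ in uE.
have bu : `|b - fourier_sum u b| <= d.
  apply: le_trans bs; apply: (fourier_sum_closer _ basisP.1) => // e es.
  by rewrite mem_undup mem_cat es.
have Tu : hs_norm T ^+ 2 - eps / 2 <= hs_part T u.
  apply: (le_trans Ts'); apply: ler_sum_sub_uniq => //; [by case: s'E|by case: uE|].
  by move=> e es; rewrite mem_undup mem_cat es orbT.
have := hs_part_le HV uE; rewrite hs_part_rank_one// => h1.
have := Tb u _ bu; rewrite ler_norml => /andP[h4 _].
have h2 : `|b| ^+ 2 - d <= `|fourier_sum u b| ^+ 2.
  rewrite /fourier_sum (orthonormal_sqnorm _ basisP.1)//.
  rewrite lerBlDl -lerBlDr -(Bessel_eq b basisP.1 uE).
  apply: (@le_trans _ _ (d ^+ 2)); first by rewrite ler_pXn2r ?nnegrE // ltW.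
  by rewrite expr2 ger_pMr// ge_min lexx.
have h3 : t ^+ 2 * (`|a| ^+ 2 * (`|b| ^+ 2 - d)) <=
          t ^+ 2 * (`|a| ^+ 2 * `|fourier_sum u b| ^+ 2).
  by rewrite ler_wpM2l ?sqr_ge0// ler_wpM2l ?sqr_ge0.
move: dM h3; rewrite /M /c; lra.
Qed.

(** Subtract from [T] its Hilbert-Schmidt projection on [rank_one (T h) h]:
    what remains has a nonnegative square norm. *)
Lemma hs_norm_op_bound T : HS H T -> op_bound T (hs_norm T).
Proof.
move=> HT h; have [->|h0] := eqVneq h 0.
  by have [[lT _] _] := HT; rewrite (linear0_of lT) !normr0 mulr0.
have n0 : `|h| ^+ 2 != 0 by rewrite expf_eq0/= normr_eq0.
have [_ e] := @hs_norm_rank_one T (- (`|h| ^+ 2)^-1) (T h) h HT.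
have := sqr_ge0 (hs_norm (T + (- (`|h| ^+ 2)^-1) *: rank_one (T h) h)).
rewrite e innerE.
have -> : hs_norm T ^+ 2 + - (`|h| ^+ 2)^-1 * `|T h| ^+ 2 *+ 2 +
  (- (`|h| ^+ 2)^-1) ^+ 2 * (`|T h| ^+ 2 * `|h| ^+ 2) =
  hs_norm T ^+ 2 - `|T h| ^+ 2 / `|h| ^+ 2 by field; rewrite normr_eq0.
rewrite subr_ge0 ler_pdivrMr ?lt0r ?n0 ?sqr_ge0// -exprMn => le.
by rewrite -(@ler_pXn2r _ 2%N) ?nnegrE ?mulr_ge0 ?hs_norm_ge0.
Qed.

(** The factor 2 comes from [(x + y)^2 <= 2 x^2 + 2 y^2]; such a
    quasi-triangle inequality is enough for the convergence arguments. *)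
Lemma HSD T T' : HS H T -> HS H T' ->
  HS H (T + T') /\ hs_norm (T + T') <= (hs_norm T + hs_norm T') *+ 2.
Proof.
move=> HT HT'; have [bT _] := HT; have [bT' _] := HT'.
have : forall s, finite_part basis s ->
    hs_part (T + T') s <= (hs_norm T ^+ 2 + hs_norm T' ^+ 2) *+ 2.
  move=> s sE; apply: (@le_trans _ _ ((hs_part T s + hs_part T' s) *+ 2)).
    rewrite /hs_part -big_split -sumrMnl/=; apply: ler_sum => e _.
    have := sqr_ge0 (`|T e - T' e|); rewrite !fctE !normD_sqr normrN.
    by rewrite [in '[T e, _]]innerC innerNl (innerC (T' e)); lra.
  by rewrite lerMn2r/= lerD ?hs_part_le.
move=> /(HS_le (bounded_linearD bT bT'))[HD le]; split=> //.
have := hs_norm_ge0 T; have := hs_norm_ge0 T' => t0 t'0.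
rewrite -(@ler_pXn2r _ 2%N) ?nnegrE ?hs_norm_ge0 ?mulrn_wge0 ?addr_ge0//.
apply: (le_trans le); have := mulr_ge0 t0 t'0; nra.
Qed.

Lemma HSZ (c : R) T : HS H T ->
  HS H (c *: T) /\ hs_norm (c *: T) <= `|c| * hs_norm T.
Proof.
move=> HT; have [bT _] := HT.
have : forall s, finite_part basis s ->
    hs_part (c *: T) s <= (`|c| * hs_norm T) ^+ 2.
  move=> s sE; have -> : hs_part (c *: T) s = `|c| ^+ 2 * hs_part T s.
    rewrite /hs_part mulr_sumr; apply: eq_bigr => e _.
    by rewrite !fctE normrZ exprMn.
  by rewrite exprMn ler_wpM2l ?sqr_ge0// hs_part_le.
move=> /(HS_le (bounded_linearZ c bT))[HZ le]; split=> //.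
by rewrite -(@ler_pXn2r _ 2%N) ?nnegrE ?mulr_ge0 ?hs_norm_ge0.
Qed.

Lemma HS0 : HS H (0 : H -> H) /\ hs_norm (0 : H -> H) = 0.
Proof.
have b0 : bounded_linear (0 : H -> H).
  apply: (@bounded_linear_of _ _ _ 0) => [c u v|h].
    by rewrite -[LHS]/(0 : H) -[RHS]/(c *: (0 : H) + 0) scaler0 addr0.
  by rewrite -[X in `|X|]/(0 : H) normr0 mul0r.
have : forall s, finite_part basis s -> hs_part (0 : H -> H) s <= 0.
  by move=> s _; rewrite /hs_part big1// => e _; rewrite normr0 expr0n.
move=> /(HS_le b0)[H0 le]; split=> //.
by apply/eqP; rewrite -sqrf_eq0 eq_le le sqr_ge0.
Qed.

Lemma HS_sum (I : Type) (s : seq I) (P : pred I) (T : I -> H -> H) :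
  (forall i, P i -> HS H (T i)) -> HS H (\sum_(i <- s | P i) T i).
Proof.
move=> HT; elim/big_ind : _ => //; first by case: HS0.
by move=> T1 T2 /HSD H1 /H1[].
Qed.

Lemma HSB T T' : HS H T -> HS H T' ->
  HS H (T - T') /\ hs_norm (T - T') <= (hs_norm T + hs_norm T') *+ 2.
Proof.
move=> HT /(HSZ (-1))[]; rewrite scaleN1r normrN1 mul1r => HT' le.
have [HB leB] := HSD HT HT'; split=> //; apply: (le_trans leB).
by rewrite lerMn2r/= lerD2l.
Qed.

End HilbertSchmidtNorm.

(** * Ridge regression with noiseless labels *)

Section Ridge.
Context {R : realType} {H : hilbertSpace R}.
Implicit Types (g h a b e : H) (T : H -> H).

Definition empirical_cov n (p : 'I_n -> H) : H -> H :=
  n%:R^-1 *: \sum_(i < n) rank_one (p i) (p i).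

Lemma empirical_covE n (p : 'I_n -> H) h :
  empirical_cov p h = n%:R^-1 *: \sum_(i < n) '[h, p i] *: p i.
Proof. by rewrite /empirical_cov fctE fct_sumE. Qed.

Lemma linear_empirical_cov T n (p : 'I_n -> H) h : linear T ->
  T (empirical_cov p h) = n%:R^-1 *: \sum_(i < n) '[h, p i] *: T (p i).
Proof.
move=> lT; rewrite empirical_covE (linearZ_of _ _ lT); congr (_ *: _).
elim/big_ind2 : _ => [|x1 x2 y1 y2 <- <-|i _]; first exact: linear0_of.
  by rewrite (linearD_of _ _ lT).
by rewrite (linearZ_of _ _ lT).
Qed.

(** The derivative at a minimum vanishes. *)
Lemma quadratic_ge0_slope (al be : R) :
  (forall t, 0 <= t * al *+ 2 + t ^+ 2 * be) -> al = 0.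
Proof.
move=> q; have b0 : 0 < `|be| + 1 by rewrite ltr_wpDl.
(* small enough for the linear term to dominate the quadratic one *)
have := q (- al / (`|be| + 1)).
have -> : - al / (`|be| + 1) * al *+ 2 + (- al / (`|be| + 1)) ^+ 2 * be =
  al ^+ 2 * ((be - (`|be| + 1) *+ 2) / (`|be| + 1) ^+ 2).
  by field; rewrite gt_eqF.
move=> ge; apply/eqP; rewrite -sqrf_eq0 eq_le sqr_ge0 andbT leNgt; apply/negP => al0.
move: ge; rewrite pmulr_rge0// leNgt => /negP; apply.
rewrite pmulr_llt0 ?invr_gt0 ?exprn_gt0//.
by have := ler_norm be; lra.
Qed.

(** Normal equations: the derivative of the objective in the direction
    [rank_one a b] vanishes for all [a] and [b]. *)
Lemma ridge_normal_eq (K W : H -> H) n (p : 'I_n -> H) (gamma : R) :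
  linear K -> HS H W ->
  (forall W', HS H W' ->
    n%:R^-1 * (\sum_(i < n) `|K (p i) - W (p i)| ^+ 2) + gamma * hs_norm W ^+ 2
    <= n%:R^-1 * (\sum_(i < n) `|K (p i) - W' (p i)| ^+ 2)
       + gamma * hs_norm W' ^+ 2) ->
  forall b, W (empirical_cov p b + gamma *: b) = K (empirical_cov p b).
Proof.
move=> lK HW Wmin b; have lW : linear W by case: HW => -[].
suff: forall a, '[W (empirical_cov p b + gamma *: b) - K (empirical_cov p b), a] = 0.
  by move=> /inner_eq0/eqP; rewrite subr_eq0 => /eqP.
move=> a; rewrite (linearD_of _ _ lW) (linearZ_of _ _ lW) (linear_empirical_cov _ _ lW)
  (linear_empirical_cov _ _ lK).
rewrite innerBl innerDl !innerZl !inner_suml.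
apply: (@quadratic_ge0_slope _
  (n%:R^-1 * (\sum_(i < n) '[b, p i] ^+ 2 * `|a| ^+ 2)
   + gamma * (`|a| ^+ 2 * `|b| ^+ 2))) => t.
have [HW' hsW'] := @hs_norm_rank_one R H W t a b HW.
have := Wmin _ HW'; rewrite hsW' -subr_ge0; congr (0 <= _).
set W' := W + _.
have -> : \sum_(i < n) `|K (p i) - W' (p i)| ^+ 2 =
    \sum_(i < n) `|K (p i) - W (p i)| ^+ 2
    + t * (\sum_(i < n) '['[b, p i] *: W (p i), a]
           - \sum_(i < n) '['[b, p i] *: K (p i), a]) *+ 2
    + t ^+ 2 * (\sum_(i < n) '[b, p i] ^+ 2 * `|a| ^+ 2).
  rewrite -sumrB !mulr_sumr -sumrMnl -!big_split/=; apply: eq_bigr => i _.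
  have -> : K (p i) - W' (p i) = (K (p i) - W (p i)) + (- (t * '[p i, b])) *: a.
    by rewrite /W' !fctE /rank_one opprD addrA scaleNr scalerA.
  rewrite normD_sqr normrZ exprMn real_normK ?num_real// innerC !innerZl.
  by rewrite (innerC a) innerBl (innerC (p i) b); ring.
ring.
Qed.

(** Surjectivity of a positive finite-rank perturbation of the
    multiplication by [gamma]; the rank-one summands are added one at a time by
    the Sherman-Morrison formula. *)
Lemma resolvent_ex (I : Type) (s : seq I) (p : I -> H) (c gamma : R) :
  0 <= c -> 0 < gamma ->
  forall b, exists v, c *: (\sum_(i <- s) '[v, p i] *: p i) + gamma *: v = b.
Proof.
move=> c0 g0; elim: s => [|i s IH] b.
  exists (gamma^-1 *: b).
  by rewrite big_nil scaler0 add0r scalerA mulfV ?scale1r// gt_eqF.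
have [v vb] := IH b; have [w wp] := IH (p i).
pose d := 1 + c * '[w, p i].
have d0 : 0 < d.
  rewrite ltr_pwDl// mulr_ge0// -[X in '[_, X]]wp innerDr !innerZr.
  rewrite addr_ge0// mulr_ge0 ?inner_ge0 ?(ltW g0)//.
  rewrite innerC inner_suml sumr_ge0// => j _.
  by rewrite innerZl (innerC (p j)) -expr2 sqr_ge0.
pose t := c * '[v, p i] / d; exists (v - t *: w).
have E : c *: (\sum_(j <- s) '[v - t *: w, p j] *: p j) + gamma *: (v - t *: w)
  = b - t *: p i.
  have -> : \sum_(j <- s) '[v - t *: w, p j] *: p j =
      \sum_(j <- s) '[v, p j] *: p j - t *: \sum_(j <- s) '[w, p j] *: p j.
    rewrite scaler_sumr -sumrB; apply: eq_bigr => j _.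
    by rewrite innerBl innerZl scalerBl scalerA.
  by rewrite -vb -wp !scalerBr scalerDr !scalerA !(mulrC t) opprD addrACA.
rewrite big_cons scalerDr -addrA E scalerA addrCA -scalerBl.
suff -> : c * '[v - t *: w, p i] - t = 0 by rewrite scale0r addr0.
rewrite innerBl innerZl /t.
have -> : c * ('[v, p i] - c * '[v, p i] / d * '[w, p i]) - c * '[v, p i] / d =
  c * '[v, p i] * (d - (1 + c * '[w, p i])) / d by field; rewrite gt_eqF.
by rewrite subrr mulr0 mul0r.
Qed.

(** Write [gamma] as [gamma^s gamma^(1 - s)] and bound the bases of
    [gamma^(1 - s)] and [lam^s] by [lam + gamma]. *)
Lemma powR_shift_le (lam gamma s : R) : 0 <= lam -> 0 < gamma -> 0 < s <= 1 ->
  gamma * lam `^ s <= gamma `^ s * (lam + gamma).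
Proof.
move=> l0 g0 /andP[s0 s1]; have m0 : 0 < lam + gamma by rewrite ltr_wpDl.
have -> : gamma * lam `^ s = gamma `^ s * (gamma `^ (1 - s) * lam `^ s).
  rewrite mulrA -powRD ?(gt_eqF g0) ?implybT//.
  by rewrite addrCA subrr addr0 powRr1 ?ltW.
have mE : lam + gamma = (lam + gamma) `^ (1 - s) * (lam + gamma) `^ s.
  by rewrite -powRD ?(gt_eqF m0) ?implybT// subrK powRr1 ?ltW.
rewrite ler_wpM2l ?powR_ge0// [leRHS]mE ler_pM ?powR_ge0//.
  by rewrite ge0_ler_powR ?nnegrE ?subr_ge0 ?lerDr// ltW.
by rewrite ge0_ler_powR ?nnegrE ?lerDl// ltW.
Qed.

(** On each eigenvector this is [powR_shift_le]. *)
Lemma frac_power_resolvent_le (Sig S : H -> H) (s gamma : R) :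
  bounded_linear Sig -> is_frac_power Sig s S -> 0 < s <= 1 -> 0 < gamma ->
  forall v, gamma * `|S v| <= gamma `^ s * `|Sig v + gamma *: v|.
Proof.
move=> bSig [bS [E [lam [oE lamE]]]] s01 g0 v.
have lSig : linear Sig by case: bSig.
have lS : linear S by case: bS.
have bQ : bounded_linear (gamma `^ s *: (Sig + gamma *: id)).
  by apply/bounded_linearZ/bounded_linearD => //;
    exact/bounded_linearZ/id_bounded_linear.
rewrite -[X in X * `|S v|]gtr0_norm// -[X in X * `|Sig _ + _|]ger0_norm ?powR_ge0//.
rewrite -!normrZ.
apply: (norm_le_of_basis oE (bounded_linearZ gamma bS) bQ) => {}v t tE.
have [oE1 _] := oE.
rewrite -(@ler_pXn2r _ 2%N) ?nnegrE//.
have -> : (gamma *: S) (fourier_sum t v) =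
    \sum_(e <- t) (gamma * ('[v, e] * lam e `^ s)) *: e.
  rewrite fctE -linear_fourier// scaler_sumr; apply: eq_big_seq => e et.
  by have [_ _ ->] := lamE e (tE.2 _ et); rewrite !scalerA.
have -> : (gamma `^ s *: (Sig + gamma *: id)) (fourier_sum t v) =
    \sum_(e <- t) (gamma `^ s * ('[v, e] * (lam e + gamma))) *: e.
  rewrite !fctE -linear_fourier// [X in _ + gamma *: X]/fourier_sum scaler_sumr.
  rewrite -big_split/= scaler_sumr; apply: eq_big_seq => e et.
  by have [_ -> _] := lamE e (tE.2 _ et);
    rewrite !scalerA -scalerDl scalerA (mulrC gamma) -mulrDr.
rewrite !(orthonormal_sqnorm _ oE1)// big_seq [leRHS]big_seq.
apply: ler_sum => e et; have [l0 _ _] := lamE e (tE.2 _ et).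
rewrite !(mulrCA _ '[v, e]) [leLHS]exprMn [leRHS]exprMn ler_wpM2l ?sqr_ge0//.
rewrite ler_pXn2r ?nnegrE ?mulr_ge0 ?powR_ge0 ?addr_ge0 ?(ltW g0)//.
exact: powR_shift_le.
Qed.

(** With [C] the empirical covariance and [v] solving [(C + gamma) v = h],
    the normal equations give [W h - K h = - gamma K v]. The operator [S] is
    controlled through [Sig + gamma], and [(Sig + gamma) v = h - (C - Sig) v]
    brings in the deviation [D]. *)
Lemma ridge_error_le (K W B S Sig : H -> H) n (p : 'I_n -> H) (gamma s D : R) :
  linear K -> HS H W -> HS H B -> bounded_linear Sig -> is_frac_power Sig s S ->
  (forall h, K h = B (S h)) -> 0 < s <= 1 -> 0 < gamma -> 0 <= D ->
  (forall W', HS H W' ->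
    n%:R^-1 * (\sum_(i < n) `|K (p i) - W (p i)| ^+ 2) + gamma * hs_norm W ^+ 2
    <= n%:R^-1 * (\sum_(i < n) `|K (p i) - W' (p i)| ^+ 2)
       + gamma * hs_norm W' ^+ 2) ->
  op_bound (empirical_cov p - Sig) D ->
  forall h, `|W h - K h| <= hs_norm B * gamma `^ s * (1 + D / gamma) * `|h|.
Proof.
move=> lK HW HB bSig fS KB s01 g0 D0 Wmin CD h.
have ni0 : 0 <= n%:R^-1 :> R by rewrite invr_ge0.
have [v vh] := resolvent_ex (index_enum 'I_n) p ni0 g0 h.
rewrite -empirical_covE in vh.
have -> : W h - K h = - (gamma *: K v).
  rewrite -vh (ridge_normal_eq lK HW Wmin) (linearD_of _ _ lK) (linearZ_of _ _ lK).
  by rewrite opprD addrA subrr add0r.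
rewrite normrN normrZ gtr0_norm// KB.
have vle : `|v| <= `|h| / gamma.
  rewrite ler_pdivlMr//; have [->|v0] := eqVneq v 0; first by rewrite normr0 mul0r.
  rewrite -(@ler_pM2l _ `|v|) ?normr_gt0//.
  apply: le_trans (norm_inner_le v h); apply: le_trans (ler_norm _).
  rewrite -[in leRHS]vh innerDr innerZr innerE mulrA -expr2 mulrC lerDr.
  rewrite innerC empirical_covE innerZl mulr_ge0// inner_suml sumr_ge0// => i _.
  by rewrite innerZl (innerC (p i)) -expr2 sqr_ge0.
have gS := frac_power_resolvent_le bSig fS s01 g0 v.
have Sv : `|Sig v + gamma *: v| <= (1 + D / gamma) * `|h|.
  have -> : Sig v + gamma *: v = h - (empirical_cov p - Sig) v.
    have -> : (empirical_cov p - Sig) v = empirical_cov p v - Sig v by [].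
    by rewrite -vh opprB [RHS]addrC addrA subrK.
  apply: (le_trans (ler_normB _ _)); rewrite mulrDl mul1r lerD2l.
  by rewrite -mulrA (le_trans (CD v))// ler_wpM2l// mulrC.
apply: (@le_trans _ _ (hs_norm B * (gamma * `|S v|))).
  by rewrite mulrCA ler_wpM2l ?(ltW g0)//; exact: hs_norm_op_bound.
rewrite -!mulrA ler_wpM2l ?hs_norm_ge0//; apply: (le_trans gS).
by rewrite ler_wpM2l ?powR_ge0.
Qed.

End Ridge.

(** * Tail bounds for sums of independent vectors *)

Section Concentration.
Context {R : realType} {V : lmodType R} (f : V -> V -> R) (fP : psd_form f).
Context {I : finType} (p : I -> R) (y : I -> V) (b : R).
Hypotheses (p_ge0 : forall i, 0 <= p i) (p_sum1 : \sum_i p i = 1).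
Hypotheses (y_mean0 : \sum_i p i *: y i = 0) (b_gt0 : 0 < b).
Hypothesis (y_le : forall i, f (y i) (y i) <= b ^+ 2).

(** Invert [1 - u <= expR (- u)]. *)
Lemma expR_le_quadratic (u : R) : u <= 2^-1 -> expR u <= 1 + u + u ^+ 2 *+ 2.
Proof.
move=> u12; have h : 1 - u <= (expR u)^-1 by rewrite -expRN expR_ge1Dx.
have u1 : 0 < 1 - u by lra.
have : expR u <= (1 - u)^-1.
  by rewrite -[leLHS]invrK lef_pV2 ?posrE ?invr_gt0 ?expR_gt0.
move=> /le_trans; apply.
rewrite -[leLHS]mul1r ler_pdivrMr// -subr_ge0.
have -> : (1 + u + u ^+ 2 *+ 2) * (1 - u) - 1 = u ^+ 2 * (1 - u *+ 2) by ring.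
by rewrite mulr_ge0 ?sqr_ge0//; lra.
Qed.

Lemma sum_tuple_cons k (F : k.+1.-tuple I -> R) :
  \sum_t F t = \sum_i \sum_(t : k.-tuple I) F [tuple of i :: t].
Proof.
rewrite pair_big/= (reindex (fun x : I * k.-tuple I => [tuple of x.1 :: x.2]))//.
exists (fun t => (thead t, [tuple of behead t])) => [[i t] _|t _] /=.
  by congr (_, _); apply: val_inj.
by rewrite [RHS]tuple_eta; apply: val_inj.
Qed.

(** A word over [I] records the outcomes of successive independent draws
    from [p]. *)
Definition path_weight (t : seq I) : R := \prod_(i <- t) p i.

Definition path_sum (t : seq I) : V := \sum_(i <- t) y i.

Lemma path_weight_ge0 t : 0 <= path_weight t.
Proof. exact: prodr_ge0. Qed.

Lemma psd_mean0 s : \sum_i p i * f s (y i) = 0.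
Proof.
case: (fP) => _ fs _.
have -> : \sum_i p i * f s (y i) = f (\sum_i p i *: y i) s.
  elim/big_ind2 : _ => [|x1 x2 y1 y2 -> ->|i _].
  - by have := psdZl fP 0 0 s; rewrite scale0r mul0r.
  - by rewrite (psdDl fP).
  - by rewrite (psdZl fP) fs.
by rewrite y_mean0; have := psdZl fP 0 0 s; rewrite scale0r mul0r.
Qed.

(** Hoeffding's argument applied to the cross term of [f (s + y i) (s + y
    i)]: its mean is zero, so it contributes its square only, which is at most a
    multiple of [f s s]. The constant 32 is such that this multiple is [be /
    n]. *)
Lemma gaussian_moment_step n (be be1 : R) s : (0 < n)%N ->
  be * (32%:R * n%:R * b ^+ 2) = 1 -> 0 <= be1 -> be1 <= be *+ 2 ->
  f s s <= (n%:R * b) ^+ 2 ->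
  \sum_i p i * expR (be1 * f (s + y i) (s + y i)) <=
  expR (be *+ 2 * b ^+ 2 + (be1 + be / n%:R) * f s s).
Proof.
move=> n0 beE be10 be1le sle.
have n0' : 0 < n%:R :> R by rewrite ltr0n.
have be0 : 0 < be.
  have q : 0 < 32%:R * n%:R * b ^+ 2 by rewrite !mulr_gt0// exprn_gt0.
  by rewrite -(@pmulr_lgt0 _ (32%:R * n%:R * b ^+ 2))// beE.
case: (fP) => _ fs f0.
pose u i := be1 *+ 2 * f s (y i).
have uu i : u i ^+ 2 <= 16%:R * be ^+ 2 * b ^+ 2 * f s s.
  have h1 := psd_CauchySchwarz fP s (y i).
  have h2 : f s s * f (y i) (y i) <= f s s * b ^+ 2 by rewrite ler_wpM2l.
  have h3 := le_trans h1 h2.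
  have h4 : (be1 *+ 2) ^+ 2 <= (be *+ 4) ^+ 2.
    by rewrite ler_pXn2r ?nnegrE ?mulrn_wge0 ?(ltW be0)//; lra.
  rewrite /u exprMn.
  apply: (@le_trans _ _ ((be *+ 4) ^+ 2 * (f s s * b ^+ 2))).
    by rewrite ler_pM ?sqr_ge0.
  by rewrite le_eqVlt; apply/orP; left; apply/eqP; ring.
have u12 i : u i <= 2^-1.
  apply: le_trans (ler_norm _) _; rewrite -(@ler_pXn2r _ 2%N) ?nnegrE//.
  rewrite real_normK ?num_real//; apply: (le_trans (uu i)).
  apply: (@le_trans _ _ (16%:R * be ^+ 2 * b ^+ 2 * (n%:R * b) ^+ 2)).
    by rewrite ler_wpM2l// mulr_ge0 ?sqr_ge0// mulr_ge0 ?sqr_ge0.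
  have -> : 16%:R * be ^+ 2 * b ^+ 2 * (n%:R * b) ^+ 2 =
    64%:R^-1 * (be * (32%:R * n%:R * b ^+ 2)) ^+ 2 by field.
  by rewrite beE; lra.
have term i : p i * expR (be1 * f (s + y i) (s + y i)) <=
    expR (be *+ 2 * b ^+ 2 + be1 * f s s) *
    (p i * (1 + 32%:R * be ^+ 2 * b ^+ 2 * f s s) + p i * u i).
  rewrite (psdD fP) -mulrDr mulrCA ler_wpM2l//.
  have -> : be1 * (f s s + f s (y i) *+ 2 + f (y i) (y i)) =
    be1 * f (y i) (y i) + be1 * f s s + u i by rewrite /u; ring.
  rewrite expRD ler_pM ?expR_ge0//.
    by rewrite ler_expR lerD2r ler_pM ?y_le ?f0.
  apply: (le_trans (expR_le_quadratic (u12 i))).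
  by have := uu i; lra.
apply: (le_trans (ler_sum _ (fun i _ => term i))).
rewrite -mulr_sumr big_split/= -mulr_suml p_sum1 mul1r.
have -> : \sum_i p i * u i = be1 *+ 2 * \sum_i p i * f s (y i).
  by rewrite mulr_sumr; apply: eq_bigr => i _; rewrite /u mulrCA.
rewrite psd_mean0 mulr0 addr0.
have -> : be *+ 2 * b ^+ 2 + (be1 + be / n%:R) * f s s =
  (be *+ 2 * b ^+ 2 + be1 * f s s) + be / n%:R * f s s by ring.
rewrite [leRHS]expRD ler_wpM2l ?expR_ge0//.
have -> : 32%:R * be ^+ 2 * b ^+ 2 * f s s = be / n%:R * f s s.
  have -> : be / n%:R = be * (be * (32%:R * n%:R * b ^+ 2)) / n%:R by rewrite beE mulr1.
  by field; rewrite gt_eqF.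
exact: expR_ge1Dx.
Qed.

(** Induction on the number [k] of draws to come after a partial sum [s].
    The exponent grows by [be / n] at each draw, hence at most doubles. The
    bound on [f s s], which a sum of [n - k] of the vectors satisfies, keeps the
    cross terms below 1/2, the range of the quadratic bound of [expR]. *)
Lemma gaussian_moment n (be : R) : (0 < n)%N ->
  be * (32%:R * n%:R * b ^+ 2) = 1 ->
  forall k s, (k <= n)%N -> f s s <= ((n%:R - k%:R) * b) ^+ 2 ->
  \sum_(t : k.-tuple I) path_weight t *
     expR (be * f (s + path_sum t) (s + path_sum t)) <=
  expR (k%:R * (be *+ 2 * b ^+ 2) + be * (1 + k%:R / n%:R) * f s s).
Proof.
move=> n0 beE.
have n0' : 0 < n%:R :> R by rewrite ltr0n.
have be0 : 0 < be.
  have q : 0 < 32%:R * n%:R * b ^+ 2 by rewrite !mulr_gt0// exprn_gt0.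
  by rewrite -(@pmulr_lgt0 _ (32%:R * n%:R * b ^+ 2))// beE.
case: (fP) => _ fs f0.
elim=> [|k IH] s kn sle.
  rewrite (big_pred1 [tuple])/=; last by move=> t; rewrite (tuple0 t)/= eqxx.
  rewrite /path_weight /path_sum !big_nil mul1r addr0 !mul0r add0r addr0 mulr1.
  exact: lexx.
rewrite sum_tuple_cons.
have step i : \sum_(t : k.-tuple I) path_weight [tuple of i :: t] *
    expR (be * f (s + path_sum [tuple of i :: t]) (s + path_sum [tuple of i :: t]))
  <= expR (k%:R * (be *+ 2 * b ^+ 2)) *
     (p i * expR (be * (1 + k%:R / n%:R) * f (s + y i) (s + y i))).
  rewrite mulrCA -expRD.
  have -> : \sum_(t : k.-tuple I) path_weight [tuple of i :: t] *
      expR (be * f (s + path_sum [tuple of i :: t]) (s + path_sum [tuple of i :: t]))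
    = p i * \sum_(t : k.-tuple I) path_weight t *
      expR (be * f (s + y i + path_sum t) (s + y i + path_sum t)).
    rewrite mulr_sumr; apply: eq_bigr => t _.
    by rewrite /path_weight /path_sum/= !big_cons addrA mulrA.
  rewrite ler_wpM2l//; apply: IH; first exact: ltnW.
  rewrite (psdD fP).
  have m0 : 0 <= n%:R - k.+1%:R :> R by rewrite subr_ge0 ler_nat.
  have h1 : f s (y i) <= (n%:R - k.+1%:R) * b * b.
    apply: le_trans (ler_norm _) _.
    rewrite -(@ler_pXn2r _ 2%N) ?nnegrE ?mulr_ge0 ?(ltW b_gt0)//.
    rewrite real_normK ?num_real//; apply: (le_trans (psd_CauchySchwarz fP _ _)).
    by rewrite exprMn ler_pM.
  have -> : ((n%:R - k%:R) * b) ^+ 2 = ((n%:R - k.+1%:R) * b) ^+ 2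
      + (n%:R - k.+1%:R) * b * b *+ 2 + b ^+ 2.
    by rewrite -[k.+1]addn1 natrD; ring.
  by rewrite !lerD// lerMn2r/=.
apply: (le_trans (ler_sum _ (fun i _ => step i))).
rewrite -mulr_sumr.
have k1 : k%:R / n%:R <= 1 :> R.
  by rewrite ler_pdivrMr// mul1r ler_nat ltnW.
have k0 : 0 <= k%:R / n%:R :> R by rewrite divr_ge0.
have := @gaussian_moment_step n be (be * (1 + k%:R / n%:R)) s n0 beE.
move=> /(_ _ _ _)/wrap[]; [nra|nra| |].
  apply: (le_trans sle); rewrite ler_pXn2r ?nnegrE ?mulr_ge0 ?subr_ge0 ?ler_nat ?(ltW b_gt0)//.
  by rewrite ler_wpM2r ?(ltW b_gt0)// gerBl.
move=> h; apply: (le_trans (ler_wpM2l (expR_ge0 _) h)).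
rewrite -expRD ler_expR le_eqVlt; apply/orP; left; apply/eqP.
by rewrite -[k.+1]addn1 natrD; field; rewrite gt_eqF.
Qed.

(** Hoeffding's inequality for vectors: Markov's inequality for the Gaussian
    moment. *)
Lemma path_sum_tail n (L : R) : (0 < n)%N ->
  \sum_(t : n.-tuple I |
      32%:R * n%:R * b ^+ 2 * (1 + L) < f (path_sum t) (path_sum t))
    path_weight t <= expR (- L).
Proof.
move=> n0; pose D := 32%:R * n%:R * b ^+ 2.
have D0 : 0 < D by rewrite !mulr_gt0 ?ltr0n// exprn_gt0.
have beE : D^-1 * D = 1 by rewrite mulVf// gt_eqF.
have f00 : f 0 0 = 0 by have := psdZl fP 0 0 0; rewrite scale0r mul0r.
(* the moment is at most [expR 1], as [n * (2 / D) * b ^ 2] is 1/16 *)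
have := @gaussian_moment n D^-1 n0 beE n 0 (leqnn _).
rewrite f00 sqr_ge0 => /(_ isT); rewrite mulr0 addr0 => mom.
have e16 : n%:R * (D^-1 *+ 2 * b ^+ 2) <= 1.
  have -> : n%:R * (D^-1 *+ 2 * b ^+ 2) =
      16%:R^-1 * (D^-1 * (32%:R * n%:R * b ^+ 2)).
    by move: (D^-1) => z; field.
  by rewrite -/D beE; lra.
apply: (@le_trans _ _ (\sum_(t : n.-tuple I) path_weight t *
   expR (D^-1 * f (path_sum t) (path_sum t) - (1 + L)))).
  rewrite [leRHS](bigID (fun t : n.-tuple I => D * (1 + L) < f (path_sum t) (path_sum t)))/=.
  rewrite ler_wpDr//.
    by apply: sumr_ge0 => t _; rewrite mulr_ge0 ?path_weight_ge0 ?expR_ge0.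
  apply: ler_sum => t lt; rewrite ler_peMr ?path_weight_ge0//.
  rewrite -[leLHS]expR0 ler_expR subr_ge0 mulrC ler_pdivlMr// mulrC; exact: (ltW lt).
apply: (@le_trans _ _ (expR 1 * expR (- (1 + L)))); last first.
  by rewrite -expRD ler_expR; lra.
have -> : \sum_(t : n.-tuple I) path_weight t *
   expR (D^-1 * f (path_sum t) (path_sum t) - (1 + L)) =
   (\sum_(t : n.-tuple I) path_weight t *
     expR (D^-1 * f (0 + path_sum t) (0 + path_sum t))) * expR (- (1 + L)).
  by rewrite mulr_suml; apply: eq_bigr => t _; rewrite add0r expRD mulrA.
rewrite ler_wpM2r ?expR_ge0//; apply: (le_trans mom).
by rewrite ler_expR.
Qed.

End Concentration.

(** * Simple functions and their cells *)

Section SimpleFunctions.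
Context {R : realType} {d : measure_display} {X : measurableType d}.
Context {V : lmodType R}.
Implicit Types (s : @simpleFun R d X V) (mu : probability X R).

(** The values of [pattern s] cut the space into the cells on which [s] is
    constant. *)
Definition pattern s (x : X) : {set 'I_(sf_size s)} :=
  [set i | x \in sf_set i].

Definition cell s (J : {set 'I_(sf_size s)}) : set X := [set x | pattern s x = J].

Definition cell_value s (J : {set 'I_(sf_size s)}) : V :=
  \sum_(i in J) sf_val i.

Lemma sf_fun_pattern s x : sf_fun s x = cell_value (pattern s x).
Proof.
rewrite /sf_fun /cell_value [RHS]big_mkcond/=; apply: eq_bigr => i _.
by rewrite inE indicE; case: (x \in _); rewrite ?scale1r ?scale0r.
Qed.

Lemma measurable_cell s J : measurable (cell (s := s) J).
Proof.
have -> : cell J = \bigcap_(i in [set: 'I_(sf_size s)])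
    (if i \in J then sf_set i else ~` sf_set i).
  apply/seteqP; split=> [x <- i _|x xJ] /=.
    by rewrite inE; case: ifPn => [/set_mem|/negP xi] //; apply: contra_not xi => /mem_set.
  apply/setP => i; rewrite inE; have := xJ i I; case: ifPn => _ xi.
    exact/mem_set.
  by apply/negbTE/negP => /set_mem.
apply: fin_bigcap_measurable; first exact: finite_finset.
move=> i _; case: ifP => _; first exact: sf_measurable.
by apply: measurableC; exact: sf_measurable.
Qed.

Lemma pattern_bigcup s (Q : {set 'I_(sf_size s)} -> set X) :
  [set x | Q (pattern s x) x] = \bigcup_(J in setT) (cell J `&` Q J).
Proof.
apply/seteqP; split=> [x Qx|x [J _ [<- //]]].
by exists (pattern s x) => //; split.
Qed.

Lemma measurable_pattern s (Q : {set 'I_(sf_size s)} -> set X) :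
  (forall J, measurable (Q J)) -> measurable [set x | Q (pattern s x) x].
Proof.
move=> mQ; rewrite pattern_bigcup; apply: fin_bigcup_measurable.
  exact: finite_finset.
by move=> J _; apply: measurableI => //; exact: measurable_cell.
Qed.

(** [Q] is arbitrary because a simple function takes finitely many
    values. *)
Lemma measurable_pattern2 s s' (Q : V -> V -> Prop) :
  measurable [set x | Q (sf_fun s x) (sf_fun s' x)].
Proof.
have -> : [set x | Q (sf_fun s x) (sf_fun s' x)] = [set x |
    [set x' | Q (cell_value (pattern s x)) (sf_fun s' x')] x].
  by apply/seteqP; split=> x /=; rewrite !sf_fun_pattern.
apply: (@measurable_pattern s (fun J => [set x' | Q (cell_value J) (sf_fun s' x')])) => J.
have -> : [set x' | Q (cell_value J) (sf_fun s' x')] =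
    [set x' | [set _ : X | Q (cell_value J) (cell_value (pattern s' x'))] x'].
  by apply/seteqP; split=> x /=; rewrite !sf_fun_pattern.
apply: (@measurable_pattern s' (fun J' => [set _ | Q (cell_value J) (cell_value J')])).
move=> J'; have [q|nq] := pselect (Q (cell_value J) (cell_value J')).
  by rewrite (_ : [set _ | _] = setT)//; apply/seteqP; split.
by rewrite (_ : [set _ | _] = set0)//; apply/seteqP; split.
Qed.

Lemma prob_pattern mu s (Q : pred {set 'I_(sf_size s)}) :
  mu [set x | Q (pattern s x)] = (\sum_(J | Q J) fine (mu (cell (s := s) J)))%:E.
Proof.
have -> : [set x | Q (pattern s x)] = \bigcup_(J in [set` Q]) cell (s := s) J.
  apply/seteqP; split=> [x Qx|x [J QJ xJ]]; last by rewrite /= xJ.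
  by exists (pattern s x).
rewrite measure_fin_bigcup; last 3 first.
- exact: finite_finset.
- by move=> J J' _ _ [x [<- <-]].
- by move=> J _; exact: measurable_cell.
rewrite -sumEFin -big_enum/= (fsbig_seq _ _ (enum_uniq Q)).
rewrite (_ : [set` enum Q] = [set` Q]).
  by apply: eq_fsbigr => J _; rewrite fineK// fin_num_measure//; exact: measurable_cell.
by apply/seteqP; split=> J /=; rewrite mem_enum.
Qed.

Lemma sum_prob_cell mu s : \sum_J fine (mu (cell (s := s) J)) = 1.
Proof.
apply: EFin_inj; rewrite -(@prob_pattern mu s xpredT) -(probability_setT mu).
by congr (mu _); apply/seteqP; split.
Qed.

Lemma sf_integral_cell mu s :
  sf_integral mu s = \sum_J fine (mu (cell (s := s) J)) *: cell_value J.
Proof.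
have e i : fine (mu (sf_set i)) =
    \sum_(J : {set 'I_(sf_size s)} | i \in J) fine (mu (cell (s := s) J)).
  have -> : sf_set i = [set x | i \in pattern s x].
    by apply/seteqP; split=> x /=; rewrite inE => xi; [exact: mem_set|exact: set_mem].
  by rewrite (prob_pattern mu (fun J : {set 'I_(sf_size s)} => i \in J)).
rewrite /sf_integral (eq_bigr _ (fun i _ => congr1 (fun c => c *: sf_val i) (e i))).
rewrite (eq_bigr (fun i => \sum_(J : {set 'I_(sf_size s)} | i \in J)
    fine (mu (cell (s := s) J)) *: sf_val i)); last by move=> i _; rewrite scaler_suml.
rewrite (exchange_big_dep predT)//=; apply: eq_bigr => J _.
by rewrite /cell_value scaler_sumr.
Qed.

(** The integral of a nonnegative function is the supremum of the integrals
    of the simple functions below it; for a function of unknown measurability,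
    such as the distance between a simple function and a Bochner integrable one,
    this is the only handle. *)
Lemma cell_sum_le_integral mu s (c : {set 'I_(sf_size s)} -> R) (f : X -> R) :
  (forall J, 0 <= c J) -> (forall x, c (pattern s x) <= f x) ->
  ((\sum_J c J * fine (mu (cell (s := s) J)))%:E <= \int[mu]_x (f x)%:E)%E.
Proof.
move=> c0 cf.
have f0 x : 0 <= f x by exact: le_trans (c0 _) (cf x).
apply: (@le_trans _ _ (\int[mu]_x (c (pattern s x))%:E)%E).
  have -> : (\int[mu]_x (c (pattern s x))%:E)%E =
      (\int[mu]_x (\sum_(J <- enum {set 'I_(sf_size s)})
         ((c J)%:E * (\1_(cell (s := s) J) x)%:E)))%E.
    apply: eq_integral => x _; rewrite big_enum/= (bigD1 (pattern s x))//=.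
    rewrite big1 ?adde0; last first.
      move=> J nJ; rewrite indicE memNset ?mule0// => Jx.
      by rewrite Jx eqxx in nJ.
    by rewrite indicE mem_set// mule1.
  have mI J : measurable_fun [set: X] (EFin \o (\1_(cell (s := s) J) : X -> R)).
    by apply/measurable_EFinP; apply: measurable_indic; exact: measurable_cell.
  rewrite ge0_integral_sum//; last 2 first.
  - by move=> J; apply: emeasurable_funM => //; exact: mI.
  - by move=> J x _; rewrite mule_ge0 ?lee_fin.
  rewrite big_enum/= -sumEFin; apply: lee_sum => J _.
  rewrite ge0_integralZl_EFin//; last exact: mI.
  rewrite integral_indic//; last exact: measurable_cell.
  rewrite setIT EFinM fineK// fin_num_measure//; exact: measurable_cell.
rewrite !ge0_integralTE; [|by move=> x; rewrite lee_fin..].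
apply: le_ereal_sup => _ [h hc <-]; exists h => // x.
by apply: (le_trans (hc x)); rewrite lee_fin.
Qed.

End SimpleFunctions.

(** * Discretisation of a distribution *)

Section Discretize.
Context {R : realType} {d : measure_display} {X : measurableType d}.
Context {H : hilbertSpace R} (mu : probability X R).
Implicit Types (F : X -> H -> H) (t : nat -> @simpleFun R d X (H -> H)).

Lemma sf_fun_HS (s : @simpleFun R d X (H -> H)) x :
  (forall i, HS H (sf_val (s := s) i)) -> HS H (sf_fun s x).
Proof. by move=> sHS; apply: HS_sum => i _; case: (HSZ (\1_(sf_set i) x) (sHS i)). Qed.

(** Egorov's theorem for the approximants of a Bochner measurable function.
    The sets of small oscillation are measurable as they involve simple
    functions only, whereas the distance to [F] may fail to be measurable. *)
Lemma bochner_uniform t F (eps : R) :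
  (forall x, HS H (F x)) -> bochner_approx (HS H) hs_norm mu t F -> 0 < eps ->
  exists A m0, [/\ measurable A, (mu (~` A) <= eps%:E)%E &
    forall m x, (m0 <= m)%N -> A x -> hs_norm (sf_fun (t m) x - F x) <= eps].
Proof.
move=> FHS [tHS [N [mN muN Ncvg]]] eps0.
have tfHS m x : HS H (sf_fun (t m) x) by apply: sf_fun_HS.
(* 4, as each triangle inequality costs a factor 2 on a sum of two errors *)
have e4 : 0 < eps / 4%:R by rewrite divr_gt0.
pose B (m : nat) : set X := [set x | forall l l', (m <= l)%N -> (m <= l')%N ->
  hs_norm (sf_fun (t l) x - sf_fun (t l') x) <= eps / 4%:R] `&` ~` N.
have mB m : measurable (B m).
  apply: measurableI; last exact: measurableC.
  have -> : [set x | forall l l', (m <= l)%N -> (m <= l')%N ->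
      hs_norm (sf_fun (t l) x - sf_fun (t l') x) <= eps / 4%:R] =
    \bigcap_(l in [set l | (m <= l)%N]) \bigcap_(l' in [set l | (m <= l)%N])
      [set x | hs_norm (sf_fun (t l) x - sf_fun (t l') x) <= eps / 4%:R].
    apply/seteqP; split=> [x Bx l /= ml l' /= ml'|x Bx l l' ml ml'].
      exact: Bx.
    exact: (Bx l ml l' ml').
  apply: bigcap_measurableType => l _; apply: bigcap_measurableType => l' _.
  exact: (@measurable_pattern2 _ _ _ _ (t l) (t l')
    (fun u v => hs_norm (u - v) <= eps / 4%:R)).
have BU : \bigcup_m B m = ~` N.
  apply/seteqP; split=> [x [m _ []//]|x Nx].
  have /cvgrPdist_le/(_ (eps / 4%:R / 4%:R)) : hs_norm (sf_fun (t m) x - F x)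
      @[m --> \oo] --> (0 : R).
    by apply/not_notP => nx; apply: Nx; apply: Ncvg.
  rewrite divr_gt0// => /(_ isT)[m _ mle]; exists m => //; split=> // l l' ml ml'.
  have h1 : hs_norm (sf_fun (t l) x - F x) <= eps / 4%:R / 4%:R.
    by have := mle l ml; rewrite /= sub0r normrN ger0_norm ?hs_norm_ge0.
  have h2 : hs_norm (sf_fun (t l') x - F x) <= eps / 4%:R / 4%:R.
    by have := mle l' ml'; rewrite /= sub0r normrN ger0_norm ?hs_norm_ge0.
  have [g1 _] := HSB (tfHS l x) (FHS x); have [g2 _] := HSB (tfHS l' x) (FHS x).
  have -> : sf_fun (t l) x - sf_fun (t l') x =
    (sf_fun (t l) x - F x) - (sf_fun (t l') x - F x) by rewrite opprB subrKA.
  have [_ le] := HSB g1 g2; apply: (le_trans le); lra.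
have ndB : {homo B : n m / (n <= m)%N >-> (n <= m)%O}.
  move=> n m nm; apply/subsetPset => x [Bx Nx]; split=> // l l' ml ml'.
  by apply: Bx; exact: (leq_trans nm).
have muNC : mu (~` N) = 1%E by rewrite probability_setC// muN sube0.
have muB : (mu \o B) m @[m --> \oo] --> 1%E.
  rewrite -muNC -BU; apply: nondecreasing_cvg_mu => //.
  by rewrite BU; exact: measurableC.
have [m0 m0P] : exists m0, ((1 - eps)%:E < mu (B m0))%E.
  have [m _ mP] : \forall m \near \oo, ((1 - eps)%:E < (mu \o B) m)%E.
    apply: (muB [set u | ((1 - eps)%:E < u)%E]).
    by apply: open_ereal_gt'; rewrite lte_fin ltrBlDr ltrDl.
  by exists m; exact: (mP m (leqnn m)).
exists (B m0), m0; split=> //.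
  rewrite probability_setC// leeBlDr ?fin_num_measure//.
  rewrite addeC -leeBlDr// -EFinB; exact: ltW.
move=> m x m0m [Bx Nx].
have /cvgrPdist_le/(_ (eps / 4%:R)) : hs_norm (sf_fun (t m) x - F x)
      @[m --> \oo] --> (0 : R).
  by apply/not_notP => nx; apply: Nx; apply: Ncvg.
move=> /(_ e4)[l0 _ lle]; pose l := maxn l0 m0.
have h1 : hs_norm (sf_fun (t l) x - F x) <= eps / 4%:R.
  by have := lle l (leq_maxl _ _); rewrite /= sub0r normrN ger0_norm ?hs_norm_ge0.
have h2 := Bx m l m0m (leq_maxr _ _).
have [g1 _] := HSB (tfHS m x) (tfHS l x); have [g2 _] := HSB (tfHS l x) (FHS x).
have -> : sf_fun (t m) x - F x =
  (sf_fun (t m) x - sf_fun (t l) x) + (sf_fun (t l) x - F x) by rewrite subrKA.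
have [_ le] := HSD g1 g2; apply: (le_trans le); lra.
Qed.

(** The distribution is replaced by a finitely supported one. In each cell
    of a fine simple function the representative nearly minimises the distance
    between the simple function and the integrand, so that the replacement
    errors, weighted by the probabilities of the cells, add up to little more
    than the integral of that distance. *)
Lemma discretize (psi : X -> H) (Sig : H -> H) (kappa eps : R) :
  is_bochner_integral (HS H) hs_norm mu (fun x => rank_one (psi x) (psi x)) Sig ->
  (forall x, `|psi x| <= kappa) -> 0 <= kappa -> 0 < eps ->
  exists (I : finType) (C : I -> set X) (phi : I -> H) (A : set X),
  [/\ [/\ forall i, measurable (C i), forall x, exists i, C i x,
          \sum_i fine (mu (C i)) = 1 & forall i, `|phi i| <= kappa],
      measurable A /\ (mu (~` A) <= eps%:E)%E,
      forall x i, A x -> C i x ->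
        op_bound (rank_one (psi x) (psi x) - rank_one (phi i) (phi i)) eps &
      op_bound ((\sum_i fine (mu (C i)) *: rank_one (phi i) (phi i)) - Sig) eps].
Proof.
move=> [FHS SHS [t [tapp tint tsig]]] psik kappa0 eps0.
have [tHS _] := tapp.
pose F x := rank_one (psi x) (psi x).
(* both conclusions lose at most three errors of size [e] *)
pose e := eps / 4%:R; have e0 : 0 < e by rewrite divr_gt0.
have [A [m0 [mA muA AP]]] := bochner_uniform FHS tapp e0.
have [m1 _ m1P] : \forall m \near \oo,
    ((\int[mu]_x (hs_norm (sf_fun (t m) x - F x))%:E) < e%:E)%E.
  by apply: (tint [set u | (u < e%:E)%E]); apply: open_ereal_lt'; rewrite lte_fin.
have [m2 _ m2P] : \forall m \near \oo, hs_norm (sf_integral mu (t m) - Sig) <= e.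
  have /cvgrPdist_le/(_ _ e0)[m _ mP] := tsig; exists m => // l /mP/=.
  by rewrite sub0r normrN ger0_norm ?hs_norm_ge0.
pose m := maxn m0 (maxn m1 m2).
have {}AP x : A x -> hs_norm (sf_fun (t m) x - F x) <= e.
  by apply: AP; exact: leq_maxl.
have {m1P}intm := m1P m (leq_trans (leq_maxl _ _) (leq_maxr _ _)).
have {m2P}sigm := m2P m (leq_trans (leq_maxr _ _) (leq_maxr _ _)).
rewrite /= in intm sigm.
pose s := t m; pose f x := hs_norm (sf_fun s x - F x).
have sHS x : HS H (sf_fun s x) by apply: sf_fun_HS => i; exact: tHS.
have dHS x : HS H (sf_fun s x - F x) by case: (HSB (sHS x) (FHS x)).
have repP (J : {set 'I_(sf_size s)}) : exists o : option X,
    if o is Some x then cell J x /\ (forall y, cell J y -> f x <= f y + e)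
    else cell J = set0.
  have [J0|/set0P[x0 x0J]] := eqVneq (cell J) set0; first by exists None.
  have hi : has_inf [set f x | x in cell J].
    split; first by exists (f x0), x0.
    by exists 0 => _ [x _ <-]; exact: hs_norm_ge0.
  have [_ [x xJ <-] xlt] := inf_adherent e0 hi.
  exists (Some x); split=> // y yJ; apply/ltW/(lt_le_trans xlt).
  by rewrite lerD2r; apply: ge_inf; [case: hi|exists y].
have [rep repE] := choice repP.
(* an empty cell has probability zero, so its representative is immaterial *)
pose phi J := if rep J is Some x then psi x else 0.
pose c J := if rep J is Some x then Num.max 0 (f x - e) else 0.
have c0 J : 0 <= c J by rewrite /c; case: (rep J) => // x; rewrite le_max lexx.
have cf x : c (pattern s x) <= f x.
  rewrite /c; have := repE (pattern s x); case: (rep _) => [y [_ yP]|cell0].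
    by rewrite ge_max hs_norm_ge0 lerBlDr yP.
  by have : cell (pattern s x) x by []; rewrite cell0.
have sumc := cell_sum_le_integral mu c0 cf.
have near_rep J : op_bound
    (fine (mu (cell J)) *: (rank_one (phi J) (phi J) - cell_value J))
    (fine (mu (cell J)) * (c J + e)).
  have p0 : 0 <= fine (mu (cell J)) by rewrite fine_ge0.
  rewrite -{2}(ger0_norm p0); rewrite /phi /c.
  have := repE J; case: (rep J) => [x [xJ _]|->]; last first.
    rewrite measure0/= normr0 mul0r scale0r => h.
    by rewrite -[X in `|X|]/(0 : H) normr0 mul0r.
  apply: op_boundZ; rewrite -opprB; apply: op_boundN.
  have -> : cell_value J = sf_fun s x by rewrite sf_fun_pattern xJ.
  apply: op_bound_le (hs_norm_op_bound (dHS x)).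
  by rewrite -lerBlDr le_max lexx orbT.
exists {set 'I_(sf_size s)}, (cell (s := s)), phi, A; split.
- split=> [J|x||J].
  + exact: measurable_cell.
  + by exists (pattern s x).
  + exact: sum_prob_cell.
  + by rewrite /phi; case: (rep J) => [x|]; rewrite ?normr0.
- split=> //; apply: (le_trans muA); rewrite lee_fin /e ler_pdivrMr//.
  by rewrite ler_peMr ?(ltW eps0)// ler1n.
- move=> x J Ax xJ; have := AP x Ax; have := repE J; rewrite /phi.
  case: (rep J) => [y [yJ yP]|J0]; last by rewrite J0 in xJ.
  move=> fx; have fy : f y <= e *+ 2 by rewrite mulr2n (le_trans (yP _ xJ))// lerD2r.
  have -> : rank_one (psi x) (psi x) - rank_one (psi y) (psi y) =
      (sf_fun s y - F y) - (sf_fun s x - F x).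
    by rewrite !sf_fun_pattern xJ yJ opprB [RHS]addrC subrKA.
  apply: (@op_bound_le _ _ _ (f y + f x)); first by rewrite /f /e in fx fy *; lra.
  by apply: op_boundD; [|apply: op_boundN]; exact: hs_norm_op_bound.
- have -> : (\sum_J fine (mu (cell J)) *: rank_one (phi J) (phi J)) - Sig =
    (\sum_J fine (mu (cell J)) *: (rank_one (phi J) (phi J) - cell_value J))
    + (sf_integral mu s - Sig).
    rewrite sf_integral_cell addrA; congr (_ - _).
    by rewrite -big_split/=; apply: eq_bigr => J _; rewrite -scalerDr subrK.
  have iHS : HS H (sf_integral mu s - Sig).
    have sumHS : HS H (sf_integral mu s).
      by apply: HS_sum => i _; case: (HSZ (fine (mu (sf_set i))) (tHS m i)).
    by case: (HSB sumHS SHS).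
  have sume : \sum_J fine (mu (cell (s := s) J)) * (c J + e) <= e *+ 2.
    rewrite (eq_bigr (fun J => c J * fine (mu (cell J)) + e * fine (mu (cell J))));
      last by move=> J _; rewrite mulrC mulrDl.
    rewrite big_split/= -mulr_sumr sum_prob_cell mulr1 mulr2n lerD2r -lee_fin.
    exact: (le_trans sumc (ltW intm)).
  apply: (@op_bound_le _ _ _ (e *+ 2 + e)); first by rewrite /e; lra.
  apply: op_boundD.
    by apply: op_bound_le sume _; apply: op_bound_sum => J _; exact: near_rep.
  exact: op_bound_le sigm (hs_norm_op_bound iHS).
Qed.

End Discretize.

(** * Concentration of the empirical covariance *)

Section GramForm.
Context {R : realType} {H : hilbertSpace R} {I : finType} (phi : I -> H).
Implicit Types (a b : {ffun I -> R^o}) (s : seq I).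

Definition rank_one_comb (c : I -> R) : H -> H :=
  \sum_i c i *: rank_one (phi i) (phi i).

Lemma hs_norm_rank_one_comb s (c : I -> R) :
  let T := \sum_(i <- s) c i *: rank_one (phi i) (phi i) in
  HS H T /\
  hs_norm T ^+ 2 = \sum_(i <- s) \sum_(j <- s) c i * c j * '[phi i, phi j] ^+ 2.
Proof.
elim: s => [|i s [HT hT]] /=.
  by rewrite !big_nil; case: (@HS0 R H) => H0 ->; rewrite expr0n.
rewrite big_cons addrC; set T : H -> H := \sum_(i <- s) _ in HT hT *.
have [HT' ->] := hs_norm_rank_one (c i) (phi i) (phi i) HT; split=> //.
have TE : c i * '[T (phi i), phi i] =
    \sum_(j <- s) c i * c j * '[phi i, phi j] ^+ 2.
  rewrite /T fct_sumE inner_suml mulr_sumr; apply: eq_bigr => j _.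
  by rewrite fctE /rank_one !innerZl (innerC (phi j)); ring.
rewrite hT big_cons big_cons TE innerE.
have -> : \sum_(j <- s) \sum_(k <- i :: s) c j * c k * '[phi j, phi k] ^+ 2 =
    \sum_(j <- s) c i * c j * '[phi i, phi j] ^+ 2 +
    \sum_(j <- s) \sum_(k <- s) c j * c k * '[phi j, phi k] ^+ 2.
  rewrite -big_split/=; apply: eq_bigr => j _; rewrite big_cons.
  by rewrite (innerC (phi j) (phi i)) (mulrC (c j)).
ring.
Qed.

(** The Hilbert-Schmidt inner product of [rank_one_comb a] and
    [rank_one_comb b]. *)
Definition gram_form a b : R :=
  \sum_i \sum_j a i * b j * '[phi i, phi j] ^+ 2.

Lemma gram_form_hs a : HS H (rank_one_comb a) /\
  hs_norm (rank_one_comb a) ^+ 2 = gram_form a a.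
Proof. exact: (hs_norm_rank_one_comb (index_enum I) a). Qed.

Lemma gram_form_psd : psd_form gram_form.
Proof.
split=> [c a b e|a b|a].
- rewrite /gram_form mulr_sumr -big_split/=; apply: eq_bigr => i _.
  rewrite mulr_sumr -big_split/=; apply: eq_bigr => j _.
  by rewrite !ffunE /GRing.scale/=; ring.
- rewrite /gram_form exchange_big/=; apply: eq_bigr => i _; apply: eq_bigr => j _.
  by rewrite innerC; ring.
- by case: (gram_form_hs a) => _ <-; rewrite sqr_ge0.
Qed.

Lemma gram_form_le a (kappa : R) : (forall i, `|phi i| <= kappa) ->
  gram_form a a <= (\sum_i `|a i|) ^+ 2 * kappa ^+ 4.
Proof.
move=> pk.
have -> : (\sum_i `|a i|) ^+ 2 * kappa ^+ 4 =
    \sum_i \sum_j `|a i| * `|a j| * kappa ^+ 4.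
  rewrite expr2 !mulr_suml; apply: eq_bigr => i _.
  by rewrite mulr_sumr mulr_suml.
apply: ler_sum => i _; apply: ler_sum => j _.
apply: (le_trans (ler_norm _)); rewrite normrM (normrM (a i)) ler_wpM2l ?mulr_ge0//.
have k0 : 0 <= kappa by exact: le_trans (normr_ge0 _) (pk i).
rewrite (_ : kappa ^+ 4 = (kappa * kappa) ^+ 2); last by ring.
rewrite normrX ler_pXn2r ?nnegrE ?mulr_ge0//.
by apply: (le_trans (norm_inner_le _ _)); rewrite ler_pM.
Qed.

End GramForm.

Section EmpiricalCov.
Context {R : realType} {H : hilbertSpace R} {I : finType} (phi : I -> H).
Context (p : I -> R) (kappa : R).
Hypotheses (p_ge0 : forall i, 0 <= p i) (p_sum1 : \sum_i p i = 1).
Hypothesis (phi_le : forall i, `|phi i| <= kappa).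

Definition centered (i : I) : {ffun I -> R^o} := [ffun j => (j == i)%:R - p j].

Lemma rank_one_comb_centered i :
  rank_one_comb phi (centered i) = rank_one (phi i) (phi i) - rank_one_comb phi p.
Proof.
rewrite /rank_one_comb [X in X - _](_ : _ =
    \sum_j (j == i)%:R *: rank_one (phi j) (phi j)); last first.
  rewrite (bigD1 i)//= eqxx scale1r big1 ?addr0// => j /negbTE ->.
  by rewrite scale0r.
by rewrite -sumrB; apply: eq_bigr => j _; rewrite ffunE scalerBl.
Qed.

Lemma rank_one_comb_path_sum (s : seq I) :
  rank_one_comb phi (path_sum centered s) =
  \sum_(i <- s) (rank_one (phi i) (phi i) - rank_one_comb phi p).
Proof.
rewrite /path_sum; elim: s => [|i s IH].
  by rewrite !big_nil /rank_one_comb big1// => j _; rewrite ffunE scale0r.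
rewrite !big_cons -IH -rank_one_comb_centered /rank_one_comb -big_split/=.
by apply: eq_bigr => j _; rewrite ffunE scalerDl.
Qed.

(** The sharper bound [2 * kappa ^+ 2] of the norm would vanish with
    [kappa], while the tail bound for sums divides by it. *)
Lemma gram_form_centered_le i :
  gram_form phi (centered i) (centered i) <= (2 * (kappa ^+ 2 + 1)) ^+ 2.
Proof.
apply: (le_trans (gram_form_le _ phi_le)).
have s2 : \sum_j `|centered i j| <= 2.
  apply: (@le_trans _ _ (\sum_j ((j == i)%:R + p j))).
    apply: ler_sum => j _; rewrite ffunE.
    by rewrite (le_trans (ler_normB _ _))// normr_nat ger0_norm.
  rewrite big_split/= p_sum1 (bigD1 i)//= eqxx big1 ?addr0//.
  by move=> j /negbTE ->.
apply: (@le_trans _ _ (2 ^+ 2 * kappa ^+ 4)).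
  rewrite ler_wpM2r ?exprn_even_ge0// ler_pXn2r ?nnegrE// sumr_ge0//.
have := sqr_ge0 kappa; rewrite -[kappa ^+ 4]/(kappa ^+ (2 * 2)) exprM; nra.
Qed.

(** The Hilbert-Schmidt geometry of the combinations of finitely many
    rank-one operators is that of the Gram form on their coefficients, to which
    the inequality for sums of independent vectors applies. Here [q] is the
    inverse square root of [n]. *)
Lemma finite_cov_concentration n (L q : R) : (0 < n)%N -> 0 <= L -> 0 <= q ->
  n%:R * q ^+ 2 = 1 ->
  exists good : pred (n.-tuple I),
    \sum_(t | ~~ good t) path_weight p t <= expR (- L) /\
    forall t, good t -> op_bound
      (empirical_cov (fun l => phi (tnth t l)) - rank_one_comb phi p)
      (2 * (kappa ^+ 2 + 1) * (32%:R * (1 + L)) * q).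
Proof.
move=> n0 L0 q0 nq; have := gram_form_centered_le.
have : 0 < 2 * (kappa ^+ 2 + 1) by rewrite mulr_gt0// ltr_wpDl// sqr_ge0.
move: (2 * (kappa ^+ 2 + 1)) => b b0 centered_le.
have n0' : 0 < n%:R :> R by rewrite ltr0n.
pose g := gram_form phi; have gP : psd_form g := gram_form_psd phi.
have mean0 : \sum_i p i *: centered i = 0.
  apply/ffunP => j; rewrite sum_ffunE ffunE.
  under eq_bigr do rewrite !ffunE /GRing.scale/= mulrBr.
  rewrite sumrB -mulr_suml p_sum1 mul1r (bigD1 j)//= eqxx mulr1 big1 ?addr0 ?subrr//.
  by move=> i ij; rewrite eq_sym (negbTE ij) mulr0.
have tail := path_sum_tail gP p_ge0 p_sum1 mean0 b0 centered_le L n0.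
exists (fun t : n.-tuple I => g (path_sum centered t) (path_sum centered t)
   <= 32%:R * n%:R * b ^+ 2 * (1 + L)); split.
  by apply: le_trans tail; rewrite le_eqVlt; apply/orP; left; apply/eqP;
    apply: eq_bigl => t; rewrite ltNge.
move=> t gt; have [HT hT] := gram_form_hs phi (path_sum centered t).
(* as [1 <= x], the square root of [x] in the tail bound is at most [x] *)
set x := 32%:R * (1 + L); have x1 : 1 <= x by rewrite /x; lra.
have hTle : hs_norm (rank_one_comb phi (path_sum centered t)) <= n%:R * (b * x * q).
  have r0 : 0 <= n%:R * (b * x * q).
    rewrite mulr_ge0// mulr_ge0// mulr_ge0 ?(ltW b0)//; exact: le_trans ler01 x1.
  rewrite -(@ler_pXn2r _ 2%N) ?nnegrE ?hs_norm_ge0// hT.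
  apply: (le_trans gt).
  have -> : (n%:R * (b * x * q)) ^+ 2 = n%:R * q ^+ 2 * (n%:R * b ^+ 2 * x ^+ 2).
    by ring.
  rewrite nq mul1r (_ : 32%:R * n%:R * b ^+ 2 * (1 + L) = n%:R * b ^+ 2 * x).
    have nb : 0 <= n%:R * b ^+ 2 by rewrite ltW// mulr_gt0// exprn_gt0.
    rewrite ler_wpM2l// [leRHS]expr2 ler_peMl//.
    exact: le_trans ler01 x1.
  by rewrite /x; ring.
have -> : empirical_cov (fun l => phi (tnth t l)) - rank_one_comb phi p =
    n%:R^-1 *: rank_one_comb phi (path_sum centered t).
  rewrite rank_one_comb_path_sum big_tuple sumrB sumr_const card_ord scalerBr.
  by rewrite -[X in _ - _ *: X]scaler_nat scalerA mulVf ?scale1r// gt_eqF.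
have [c0 cn] : 0 <= n%:R^-1 :> R /\ `|n%:R^-1| * (n%:R * (b * x * q)) = b * x * q.
  by rewrite ger0_norm ?invr_ge0// mulKf// gt_eqF.
by rewrite -cn; apply/op_boundZ/(op_bound_le hTle)/hs_norm_op_bound.
Qed.

End EmpiricalCov.

Section Sample.
Context {R : realType} {d d' : measure_display} {X : measurableType d}.
Context {Omega : measurableType d'} (P : probability Omega R).

Lemma prob_bigU_le (I : finType) (Q : pred I) (F : I -> set Omega) :
  (forall i, measurable (F i)) ->
  measurable (\big[setU/set0]_(i | Q i) F i) /\
  (P (\big[setU/set0]_(i | Q i) F i) <= \sum_(i | Q i) P (F i))%E.
Proof.
move=> mF; elim/big_ind2 : _ => [|A a B b [mA Aa] [mB Bb]|i _ //].
  by rewrite measure0.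
split; first exact: measurableU.
by apply: (le_trans (measureU2 _ mA mB)); exact: leeD.
Qed.

Lemma sub_bigU (T : Type) (I : finType) (Q : pred I) (F : I -> set T) i x :
  Q i -> F i x -> (\big[setU/set0]_(i | Q i) F i) x.
Proof. by move=> Qi Fx; rewrite (bigD1 i)//=; left. Qed.

Lemma measurable_RV_preimage (xi : {RV P >-> X}) (A : set X) :
  measurable A -> measurable (xi @^-1` A).
Proof. by move=> mA; rewrite -[_ @^-1` _]setTI; exact: measurable_funPT. Qed.

Context {H : hilbertSpace R} (rho : probability X R).

(** The bad event is a finite union of measurable sets: some sample point
    leaves the set where the discretisation is accurate, or the word of the
    cells visited by the sample is bad. The probability of the latter is a sum
    over bad words of probabilities of cylinders, which are products by
    independence. *)
Lemma cov_concentration (psi : X -> H) (Sig : H -> H) (kappa : R) n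
    (xi : 'I_n -> {RV P >-> X}) (L q eps : R) :
  is_bochner_integral (HS H) hs_norm rho (fun x => rank_one (psi x) (psi x)) Sig ->
  (forall x, `|psi x| <= kappa) -> 0 <= kappa -> iid_sample rho xi ->
  (0 < n)%N -> 0 <= L -> 0 <= q -> n%:R * q ^+ 2 = 1 -> 0 < eps ->
  exists B : set Omega,
    [/\ measurable B, (P B <= (n%:R * eps + expR (- L))%:E)%E &
      forall w, ~ B w -> op_bound (empirical_cov (fun i => psi (xi i w)) - Sig)
        (2 * (kappa ^+ 2 + 1) * (32%:R * (1 + L)) * q + eps *+ 2)].
Proof.
move=> Sint psik kappa0 [xid xiI] n0 L0 q0 nq eps0.
have [I [C [phi [A [[mC Cx C1 phik] [mA muA] ACphi Sigphi]]]]] :=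
  discretize Sint psik kappa0 eps0.
pose p i := fine (rho (C i)).
have p0 i : 0 <= p i by rewrite fine_ge0.
have [good [tail goodP]] := finite_cov_concentration p0 C1 phik n0 L0 q0 nq.
(* the samples whose points visit the cells listed by the word [t] *)
pose cyl (t : n.-tuple I) := \bigcap_(i in [set: 'I_n]) (xi i @^-1` C (tnth t i)).
have mcyl t : measurable (cyl t).
  apply: fin_bigcap_measurable; first exact: finite_finset.
  by move=> i _; exact: measurable_RV_preimage.
have Pcyl t : P (cyl t) = (path_weight p t)%:E.
  rewrite xiI// /path_weight big_tuple -prodEFin; apply: eq_bigr => i _.
  by rewrite /p -(xid i _ (mC _)) /distribution/pushforward/= fineK// fin_num_measure//;
    exact: measurable_RV_preimage.
pose F i := xi i @^-1` (~` A).
have mF i : measurable (F i) by apply: measurable_RV_preimage; exact: measurableC.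
have PF i : (P (F i) <= eps%:E)%E.
  by apply: le_trans muA; rewrite -(xid i _ (measurableC mA)).
have [mB1 PB1] := prob_bigU_le predT mF.
have [mB2 PB2] := prob_bigU_le (predC good) mcyl.
exists (\big[setU/set0]_(i < n) F i `|` \big[setU/set0]_(t | ~~ good t) cyl t).
split; first exact: measurableU.
  apply: (le_trans (measureU2 _ mB1 mB2)); rewrite EFinD; apply: leeD.
    apply: (le_trans PB1); apply: (@le_trans _ _ (\sum_(i < n) eps%:E)%E).
      by apply: lee_sum => i _; exact: PF.
    by rewrite sumEFin sumr_const card_ord lee_fin mulr_natl.
  apply: (le_trans PB2); under eq_bigr do rewrite Pcyl.
  by rewrite sumEFin lee_fin.
move=> w nB.
have wA i : A (xi i w).
  by apply/not_notP => nA; apply: nB; left; exact: (sub_bigU (i := i)).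
have [j jP] := choice (fun i => Cx (xi i w)).
pose t : n.-tuple I := [tuple j i | i < n].
have tj i : tnth t i = j i by rewrite tnth_mktuple.
have gt : good t.
  apply/negPn/negP => nt; apply: nB; right; apply: (sub_bigU (i := t)) => // i _ /=.
  by rewrite tj; exact: jP.
have -> : empirical_cov (fun i => psi (xi i w)) - Sig =
    (empirical_cov (fun l => phi (tnth t l)) - rank_one_comb phi p)
    + ((n%:R^-1 *: \sum_(i < n) (rank_one (psi (xi i w)) (psi (xi i w))
          - rank_one (phi (tnth t i)) (phi (tnth t i))))
       + (rank_one_comb phi p - Sig)).
  rewrite sumrB scalerBr -/(empirical_cov _) -/(empirical_cov _).
  by rewrite [RHS]addrCA !subrKA.
apply: op_boundD; first exact: goodP.
rewrite mulr2n; apply: op_boundD => //.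
have -> : eps = `|n%:R^-1| * \sum_(i < n) eps.
  rewrite ger0_norm ?invr_ge0// sumr_const card_ord -[eps *+ n]mulr_natl mulKf//.
  by rewrite pnatr_eq0 -lt0n.
apply/op_boundZ/op_bound_sum => i _; rewrite tj; exact: ACphi.
Qed.

End Sample.

(** * The rate of convergence *)

Section Rate.
Context {R : realType}.
Implicit Types (r rho c N : R).

(** Both exponents of [N] have the form [(2 * t + 1)^-1 - 1 / 2], decreasing
    in [t]. *)
Lemma ridge_parameter_powR_le N c r rho : 1 <= N -> 0 < c -> 1 / 2 < rho <= r ->
  (c * N `^ (- (2 * r + 1)^-1)) `^ (r - 1 / 2) <=
  c `^ (r - 1 / 2) * N `^ (- ((2 * rho - 1) / (4 * rho + 2))).
Proof.
move=> N1 c0 /andP[rho0 rhor].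
rewrite powRM ?powR_ge0 ?(ltW c0)// -powRrM ler_wpM2l ?powR_ge0// ler_powR//.
have -> : - (2 * r + 1)^-1 * (r - 1 / 2) = (2 * r + 1)^-1 - 1 / 2.
  by field; rewrite gt_eqF//; lra.
have -> : - ((2 * rho - 1) / (4 * rho + 2)) = (2 * rho + 1)^-1 - 1 / 2.
  by field; rewrite !gt_eqF//; lra.
rewrite lerD2r lef_pV2 ?posrE//; lra.
Qed.

(** The regularisation dominates the sampling error, of order [N ^ (-
    1/2)]. *)
Lemma ridge_parameter_ge N c r : 1 <= N -> 0 < c -> 1 / 2 < r ->
  c * N `^ (- (1 / 2)) <= c * N `^ (- (2 * r + 1)^-1).
Proof.
move=> N1 c0 r0; rewrite ler_wpM2l ?(ltW c0)// ler_powR// lerN2.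
by rewrite div1r lef_pV2 ?posrE//; lra.
Qed.

Lemma powR_half_sqr N : 0 < N -> N * (N `^ (- (1 / 2))) ^+ 2 = 1.
Proof.
move=> N0; rewrite -powR_mulrn ?powR_ge0// -powRrM.
have -> : - (1 / 2) * 2%:R = -1 :> R by field.
by rewrite powR_inv1 ?(ltW N0)// mulfV// gt_eqF.
Qed.

End Rate.

Theorem theorem2p11 (R : realType) (U : finType) (U_gt0 : (0 < #|U|)%N)
    (kappa : R) (r_ G Rb c : U -> R)
    (r_bnd : forall u, 1 / 2 < r_ u <= 1) (c_gt0 : forall u, 0 < c u) :
  (* the unit [1] is neutral for this minimum, as [r_ u <= 1] *)
  let r := \big[Order.min/1]_(u : U) r_ u in
  exists A : R,
  forall (d : measure_display) (X : measurableType d) (flow : X -> U -> X)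
    (k : X -> X -> R) (H : rkhs k) (rho : U -> probability X R)
    (K Sigma B : U -> H -> H),
  let psi := feature H in
  strictly_positive_definite k ->
  (forall u, span_bounded H (flow ^~ u) (Rb u)) ->
  (forall u, is_koopman (flow ^~ u) (K u)) ->
  (forall u, bochner_measurable [set: H] (fun h : H => `|h|) (rho u) psi) ->
  (forall u, is_bochner_integral (HS H) hs_norm (rho u)
    (fun x => rank_one (psi x) (psi x)) (Sigma u)) ->
  (forall x, `|psi x| <= kappa) ->
  (forall u, HS H (K u)) ->
  (forall u, [/\ HS H (B u),
    forall h, Sigma u h = 0 -> B u h = 0,
    exists2 S, is_frac_power (Sigma u) (r_ u - 1 / 2) S
      & forall h, K u h = B u (S h)
    & hs_norm (B u) = G u]) ->
  forall (n : nat) (delta : R), (1 <= n)%N -> 0 < delta < 1 ->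
  forall (dO : measure_display) (Omega : measurableType dO)
    (P : probability Omega R) (xi : U -> 'I_n -> {RV P >-> X})
    (Khat : Omega -> U -> H -> H),
  (forall u, iid_sample (rho u) (xi u)) ->
  (forall w u, is_ridge_solution (flow ^~ u) (fun i => xi u i w)
    (c u * n%:R `^ (- (2 * r_ u + 1)^-1)) (Khat w u)) ->
  exists E : set Omega,
    [/\ measurable E, ((1 - delta)%:E <= P E)%E &
      forall w, E w -> forall (x : X) (u : U),
        `|Khat w u (psi x) - K u (psi x)| <=
          A * ln (2 * #|U|%:R / delta) * kappa
          * n%:R `^ (- ((2 * r - 1) / (4 * r + 2)))].
Proof.
move=> r.
pose b := 2 * (kappa ^+ 2 + 1).
(* [1 <= l * ln (2 * #|U|%:R / delta)] absorbs the constants into the logarithm *)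
pose l : R := (ln 2)^-1.
pose M u := l + (b * (32%:R * (l + 1)) + l *+ 2) / c u.
exists (\sum_u `|G u| * c u `^ (r_ u - 1 / 2) * M u).
move=> d X flow k H rho K Sigma B psi _ _ HK _ HSig psik _ HB.
move=> n delta n1 /andP[d0 d1] dO Omega P xi Khat Hxi Hridge.
(* for negative [kappa] the state space is empty *)
have [kappa0|kappa0] := leP 0 kappa; last first.
  exists setT; split => //.
    by rewrite probability_setT lee_fin gerBl ltW.
  move=> w _ x; suff : false by [].
  by rewrite -(lt_irreflexive kappa) (lt_le_trans kappa0)// (le_trans _ (psik x)).
have U0 : 0 < #|U|%:R :> R by rewrite ltr0n.
have U1 : 1 <= #|U|%:R :> R by rewrite ler1n.
have N0 : 0 < n%:R :> R by rewrite ltr0n.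
have N1 : 1 <= n%:R :> R by rewrite ler1n.
have l20 : 0 < ln 2 :> R by rewrite ln_gt0// ltr1n.
pose L := ln (2 * #|U|%:R / delta).
have a0 : 0 < 2 * #|U|%:R / delta by rewrite divr_gt0// mulr_gt0.
have L2 : ln 2 <= L.
  rewrite ler_ln ?posrE// ler_pdivlMr//; nra.
have L0 : 0 <= L by apply: le_trans L2; exact: ltW.
have lL : 1 <= l * L by rewrite mulrC ler_pdivlMr// mul1r.
have eL : expR (- L) = delta / 2 / #|U|%:R.
  by rewrite expRN lnK ?posrE//; field; rewrite !gt_eqF.
pose q := n%:R `^ (- (1 / 2)) : R.
have q0 : 0 < q by rewrite powR_gt0.
have nq : n%:R * q ^+ 2 = 1 by exact: powR_half_sqr.
(* fine enough to be negligible in the bound and in the probability *)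
pose eps := Num.min q (delta / 2 / #|U|%:R / n%:R).
have eps0 : 0 < eps by rewrite lt_min q0 !divr_gt0.
have epsq : eps <= q by rewrite ge_min lexx.
have neps : n%:R * eps <= delta / 2 / #|U|%:R.
  by rewrite mulrC -ler_pdivlMr// ge_min lexx orbT.
have bad u := cov_concentration (HSig u) psik kappa0 (Hxi u) n1 L0 (ltW q0) nq eps0.
have [Bad BadP] := choice bad.
have mBad u : measurable (Bad u) by case: (BadP u).
have PBad u : (P (Bad u) <= (delta / #|U|%:R)%:E)%E.
  have [_ le _] := BadP u; apply: (le_trans le); rewrite lee_fin eL.
  have -> : delta / #|U|%:R = delta / 2 / #|U|%:R + delta / 2 / #|U|%:R :> R.
    by field; rewrite gt_eqF.
  by rewrite lerD2r.
have [mE PE] := prob_bigU_le P predT mBad.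
exists (~` \big[setU/set0]_u Bad u); split.
- exact: measurableC.
- rewrite probability_setC// EFinB leeB//; apply: (le_trans PE).
  apply: (@le_trans _ _ (\sum_(u : U) (delta / #|U|%:R)%:E)%E).
    by apply: lee_sum => u _; exact: PBad.
  by rewrite sumEFin sumr_const lee_fin -[leLHS]mulr_natr divfK// gt_eqF.
move=> w nE x u.
have [_ _ /(_ w)] := BadP u.
have nBad : ~ Bad u w by move=> Bw; apply: nE; exact: (sub_bigU (i := u)).
move=> /(_ nBad) covD; set D : R := _ * q + _ in covD.
have [lK Kpsi] := HK u; case: lK => lK _.
have [HBu _ [S fS KS] hsB] := HB u.
have [_ SHS _] := HSig u; have bSig : bounded_linear (Sigma u) by case: SHS.
have [HW Wmin] := Hridge w u.
set gam := c u * _ in Wmin.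
have g0 : 0 < gam by rewrite mulr_gt0 ?powR_gt0.
have D0 : 0 <= D.
  rewrite addr_ge0 ?mulrn_wge0 ?(ltW eps0)// mulr_ge0 ?(ltW q0)//.
  by rewrite !mulr_ge0 ?addr_ge0 ?sqr_ge0.
have /andP[r1 r2] := r_bnd u.
have s01 : 0 < r_ u - 1 / 2 <= 1 by apply/andP; split; lra.
have {}Wmin W' : HS H W' ->
    n%:R^-1 * (\sum_(i < n) `|K u (psi (xi u i w)) - Khat w u (psi (xi u i w))| ^+ 2)
      + gam * hs_norm (Khat w u) ^+ 2
    <= n%:R^-1 * (\sum_(i < n) `|K u (psi (xi u i w)) - W' (psi (xi u i w))| ^+ 2)
      + gam * hs_norm W' ^+ 2.
  move=> HW'; have := Wmin W' HW'; rewrite /ridge_objective.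
  by under eq_bigr do rewrite -Kpsi; under [in X in _ <= X]eq_bigr do rewrite -Kpsi.
have := ridge_error_le lK HW HBu bSig fS KS s01 g0 D0 Wmin covD (psi x).
move=> /le_trans; apply.
have rr : 1 / 2 < r <= r_ u.
  rewrite bigmin_le andbT lt_bigmin//; first by lra.
  by move=> v _; case/andP: (r_bnd v).
have gs := ridge_parameter_powR_le N1 (c_gt0 u) rr; rewrite -/gam in gs.
set rate := n%:R `^ _ in gs *.
have Dg : 1 + D / gam <= M u * L.
  have qg : q / gam <= (c u)^-1.
    rewrite ler_pdivrMr// mulrC ler_pdivlMr// mulrC.
    exact: ridge_parameter_ge.
  have Dq : D <= (b * (32%:R * (1 + L)) + 2) * q.
    by rewrite mulrDl [X in _ <= _ + X]mulr_natl /D /b lerD2l lerMn2r.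
  have h1 : D / gam <= (b * (32%:R * (1 + L)) + 2) / c u.
    apply: (@le_trans _ _ ((b * (32%:R * (1 + L)) + 2) * (q / gam))).
      by rewrite mulrA ler_wpM2r// invr_ge0 ltW.
    rewrite ler_wpM2l// addr_ge0// mulr_ge0// ?mulr_ge0 ?addr_ge0 ?sqr_ge0//.
  have -> : M u * L = l * L + (b * (32%:R * (l + 1)) + l *+ 2) / c u * L.
    exact: mulrDl.
  apply: lerD => //; apply: (le_trans h1).
  rewrite [leRHS]mulrAC ler_wpM2r ?invr_ge0 ?(ltW (c_gt0 u))//.
  have b0 : 0 <= b by rewrite mulr_ge0 ?addr_ge0 ?sqr_ge0.
  have : b * 32%:R * 1 <= b * 32%:R * (l * L) by rewrite ler_wpM2l// mulr_ge0.
  lra.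
have G0 u' : 0 <= `|G u'| * c u' `^ (r_ u' - 1 / 2) * M u'.
  have l0 : 0 <= l by rewrite invr_ge0 ltW.
  rewrite mulr_ge0 ?mulr_ge0 ?powR_ge0// addr_ge0// divr_ge0 ?(ltW (c_gt0 u'))//.
  by rewrite addr_ge0 ?mulrn_wge0// !mulr_ge0 ?addr_ge0 ?sqr_ge0.
have rate0 : 0 <= rate by exact: powR_ge0.
apply: (@le_trans _ _ (`|G u| * c u `^ (r_ u - 1 / 2) * M u * L * kappa * rate));
  last first.
  rewrite !(ler_wpM2r _)// (bigD1 u)//= lerDl sumr_ge0//.
rewrite hsB.
have -> : `|G u| * c u `^ (r_ u - 1 / 2) * M u * L * kappa * rate =
  `|G u| * (c u `^ (r_ u - 1 / 2) * rate) * (M u * L) * kappa by ring.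
rewrite ler_pM ?mulr_ge0 ?powR_ge0 ?addr_ge0 ?divr_ge0 ?(ltW g0)//.
  by rewrite -hsB hs_norm_ge0.
rewrite ler_pM ?mulr_ge0 ?powR_ge0 ?addr_ge0 ?divr_ge0 ?(ltW g0)//.
  by rewrite -hsB hs_norm_ge0.
by rewrite ler_pM ?powR_ge0 ?ler_norm// -hsB hs_norm_ge0.
Qed.
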